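(* Let $T^+=(T^+(s))_{s\in[0,t]}$ be a telegraph meander with parameters $\lambda>0$, $c>0$, $t>0$, and let $q_{\lambda,c}(\cdot,t)$ be the density of the absolutely continuous component of the law of $T^+(t)$. Then, for $x\in[0,ct)$, $$q_{\lambda,c}(x,t)=\lim_{\epsilon\downarrow0}\frac{\mathsf{P}\{T(t)\in dx\mid \min_{0\le s\le t}T(s)\ge-\epsilon,\ V(0)=-c\}}{dx}=-\frac{\frac{\partial}{\partial x}p^-_{\lambda,c}(x,t)}{p^-_{\lambda,c}(0,t)}.$$
   Context: Let $N$ be a homogeneous Poisson process of rate $\lambda>0$, and let $V(0)$ be independent of $N$ and uniformly distributed on $\{-c,c\}$, $c>0$. Set $V(s)=V(0)(-1)^{N(s)}$ and $T(s)=\int_0^sV(u)\,du$ (telegraph process). The telegraph meander $T^+$ on $[0,t]$ is the random continuous function on $[0,t]$ whose law is that of $(T(s))_{0\le s\le t}$ conditioned on $\{\min_{0\le s\le t}T(s)\ge0\}$. The law of $T^+(t)$ is supported in $[0,ct]$, and $q_{\lambda,c}(\cdot,t)$ is taken to be the version that is continuous on $[0,ct)$. The expression $\mathsf{P}\{T(t)\in dx\mid\cdots\}/dx$ denotes the density at $x$ (with respect to Lebesgue measure) of the conditional law of $T(t)$; for fixed $\epsilon>0$ small, the version continuous in $x\in[0,ct-2\epsilon)$ is used. $p^-_{\lambda,c}(\cdot,t)$ is the density of the absolutely continuous component of the conditional law of $T(t)$ given $V(0)=-c$, namely $$p^-_{\lambda,c}(x,t)=\frac{\lambda e^{-\lambda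 t}}{2c}\left(\sqrt{\frac{ct-x}{ct+x}}\,I_1\Big(\frac{\lambda}{c}\sqrt{c^2t^2-x^2}\Big)+I_0\Big(\frac{\lambda}{c}\sqrt{c^2t^2-x^2}\Big)\right)\mathsf{1}_{(-ct,ct)}(x),$$ where $I_\nu(x)=\sum_{k\ge0}(x/2)^{2k+\nu}\frac{1}{k!\,\Gamma(\nu+k+1)}$ is the modified Bessel function of the first kind. *)

(* Defs.v *)
From HB Require Import structures.
From mathcomp Require Import all_boot all_order all_algebra.
From mathcomp Require Import all_classical all_reals all_analysis.
Import Order.TTheory GRing.Theory Num.Theory.
Import numFieldNormedType.Exports.

Set Implicit Arguments.
Unset Strict Implicit.
Unset Printing Implicit Defensive.

Local Open Scope classical_set_scope.
Local Open Scope ring_scope.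

Section Bessel.
Variable R : realType.

(* For a natural order nu, Gamma (nu + k + 1) is (nu + k)!. *)
Definition besselI (nu : nat) (x : R) : R :=
  limn (series (fun k : nat =>
    (x / 2) ^+ (2 * k + nu) / (k`!%:R * (nu + k)`!%:R))).

(* Closed form of the density of the absolutely continuous component of the
   law of T(t) given V(0) = -c. *)
Definition p_minus (lam c t x : R) : R :=
  lam * expR (- (lam * t)) / (2 * c) *
  (Num.sqrt ((c * t - x) / (c * t + x)) *
     besselI 1 (lam / c * Num.sqrt (c ^+ 2 * t ^+ 2 - x ^+ 2)) +
   besselI 0 (lam / c * Num.sqrt (c ^+ 2 * t ^+ 2 - x ^+ 2))) *
  \1_(`](- (c * t)), (c * t)[) x.

End Bessel.

Section Densities.
Variable R : realType.
Local Notation mu := (@lebesgue_measure R).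

Definition is_density (m : set R -> \bar R) (f : R -> R) : Prop :=
  [/\ measurable_fun setT f, forall x, 0 <= f x &
      forall A, measurable A -> m A = (\int[mu]_(x in A) (f x)%:E)%E].

Definition singular_to_lebesgue (nu : set R -> \bar R) : Prop :=
  exists S : set R, [/\ measurable S, mu S = 0%E & nu (~` S) = 0%E].

(* q is the density of the absolutely continuous component in the Lebesgue
   decomposition of m; nu is the singular component. *)
Definition is_ac_density (m : set R -> \bar R) (q : R -> R) : Prop :=
  [/\ measurable_fun setT q, forall x, 0 <= q x &
      exists2 nu : {measure set R -> \bar R}, singular_to_lebesgue nu &
        forall A, measurable A ->
          m A = (\int[mu]_(x in A) (q x)%:E + nu A)%E].

End Densities.

Definition sigma_of_family (R : realType) (U : Type) d (E : measurableType d)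
    (I : set R) (X : R -> U -> E) : set (set U) :=
  <<s \bigcup_(s in I) preimage_set_system setT (X s) measurable >>.

Section Probability.
Context (R : realType) (d : measure_display) (W : measurableType d).
Variable P : probability W R.

Definition cprob (E A : set W) : \bar R := (P (A `&` E) / P E)%E.

Definition independent_families (F G : set (set W)) : Prop :=
  forall A B, F A -> G B -> P (A `&` B) = (P A * P B)%E.

(* Only times s >= 0 matter; the values N s for s < 0 are unconstrained. *)
Record poisson_process (lam : R) (N : R -> W -> nat) : Prop := {
  poisson_measurable : forall s, 0 <= s -> measurable_fun setT (N s) ;
  poisson_start : forall w, N 0 w = 0%N ;
  poisson_homo : forall w s u, 0 <= s -> s <= u -> (N s w <= N u w)%N ;
  poisson_right_continuous : forall w s, 0 <= s ->
    \forall u \near s^'+, N u w = N s w ;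
  poisson_increment : forall s u k, 0 <= s -> s < u ->
    P [set w | (N u w - N s w)%N = k] = (poisson_pmf (lam * (u - s)) k)%:E ;
  poisson_independent : forall (n : nat) (s : nat -> R) (B : nat -> set nat),
    0 <= s 0%N -> (forall i, s i <= s i.+1) ->
    P (\bigcap_(i in [set i | (i < n)%N])
         [set w | B i (N (s i.+1) w - N (s i) w)%N]) =
    (\prod_(i < n) P [set w | B i (N (s i.+1) w - N (s i) w)%N])%E
}.

Definition uniform_pm (c : R) (V0 : W -> R) : Prop :=
  [/\ measurable_fun setT V0,
      P (V0 @^-1` [set c]) = (2^-1)%:E &
      P (V0 @^-1` [set - c]) = (2^-1)%:E].

Definition telegraph_driver (lam c : R) (N : R -> W -> nat) (V0 : W -> R) :=
  [/\ poisson_process lam N, uniform_pm c V0 &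
      independent_families (preimage_set_system setT V0 measurable)
                           (sigma_of_family `[0, +oo[ N)].

Definition velocity (N : R -> W -> nat) (V0 : W -> R) (s : R) (w : W) : R :=
  V0 w * (-1) ^+ N s w.

Definition telegraph (N : R -> W -> nat) (V0 : W -> R) (s : R) (w : W) : R :=
  \int[@lebesgue_measure R]_(u in `[0, s]) velocity N V0 u w.

(* Telegraph paths are continuous, so the infimum over [0, t] is attained. *)
Definition running_min (X : R -> W -> R) (t : R) (w : W) : R :=
  inf [set X s w | s in `[0, t]].

Definition min_ge (X : R -> W -> R) (t a : R) : set W :=
  [set w | a <= running_min X t w].

End Probability.

(* Tp is a version of T conditioned on its minimum over [0, t] being >= 0.  It
   may live on its own probability space (W', P').  Laws on path space are
   compared on the sigma-algebra generated by the evaluations at the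
   times s in [0, t], which on C([0, t]) is the Borel sigma-algebra. *)
Record telegraph_meander (R : realType)
    d (W : measurableType d) (P : probability W R)
    (N : R -> W -> nat) (V0 : W -> R) (t : R)
    d' (W' : measurableType d') (P' : probability W' R)
    (Tp : R -> W' -> R) : Prop := {
  meander_measurable : forall s, 0 <= s <= t -> measurable_fun setT (Tp s) ;
  meander_continuous : forall w, {within `[0, t], continuous (Tp ^~ w)} ;
  meander_law : forall A : set (R -> R),
    sigma_of_family `[0, t] (fun s (x : R -> R) => x s) A ->
    P' [set w | A (Tp ^~ w)] =
    cprob P (min_ge (telegraph N V0) t 0) [set w | A (telegraph N V0 ^~ w)]
}.

Definition meander_density (R : realType) (c t : R)
    d' (W' : measurableType d') (P' : probability W' R) (Tp : R -> W' -> R)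
    (q : R -> R) : Prop :=
  is_ac_density (fun A => P' (Tp t @^-1` A)) q /\
  {within `[0, c * t[, continuous q}.

Definition conditional_density (R : realType)
    d (W : measurableType d) (P : probability W R)
    (N : R -> W -> nat) (V0 : W -> R) (c t eps : R) (f : R -> R) : Prop :=
  is_density
    (fun A => cprob P (min_ge (telegraph N V0) t (- eps) `&` V0 @^-1` [set - c])
                      (telegraph N V0 t @^-1` A)) f /\
  {within `[0, c * t - 2 * eps[, continuous f}.

(* Main.v *)
Require Import Defs.
From HB Require Import structures.
From mathcomp Require Import all_boot all_order all_algebra.
From mathcomp Require Import all_classical all_reals all_analysis.
From mathcomp Require Import measurable_realfun.
From mathcomp Require Import ring lra zify.
Import Order.TTheory GRing.Theory Num.Theory.
Import numFieldNormedType.Exports.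

(* Sampled at the points of a grid of [0, t] with m cells, the telegraph path is
   within O(1 / m) of a walk with unit steps that turns after each step with
   probability p, where m p tends to lam t.  The turns made after steps up and
   after steps down form two independent Bernoulli sequences, so whether the walk
   makes a steps up before b steps down depends only on two independent binomial
   variables; by reflection the same holds if the walk must also stay above a
   barrier.  As m grows the binomial variables become independent Poisson variables
   U and D with means lam (t + x / c) / 2 and lam (t - x / c) / 2, and in the limit
     P(T t >= x, min T >= 0 | V0 = c) = P(D - U = 0 or 1) = 2 c / lam * p_minus x,
     P(T t >= x, min T >= - e | V0 = - c) = the integral of p_minus over [x, x + 2 e].
   Hence the meander has density - p_minus' / p_minus 0, while the conditional
   density at level e is (p_minus x - p_minus (x + 2 e)) divided by the integral of
   p_minus over [- e, e], and the ratio converges to the former. *)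

Set Implicit Arguments.
Unset Strict Implicit.
Unset Printing Implicit Defensive.

Local Open Scope classical_set_scope.
Local Open Scope ring_scope.

(** * Bessel series and the difference of two Poisson variables *)

Section Phi.
Variable R : realType.
Implicit Types (u v z x : R) (k n : nat).

(** The discrete formulas pass to the limit as tail probabilities, not as densities: tail events
    given by closed inequalities decrease with their tolerances, so continuity from above absorbs
    the grid error even at the atom x = c t, and densities reappear only by differentiating in x.
    The obstacle is that the grid error of a path is proportional to its number of jumps, which is
    unbounded; discarding the paths with more than K jumps makes it uniform, and the tolerance
    delta, K and m are fixed in that order. Let A and B be the binomial counts of turns after steps
    up and after steps down. For a start upward, reflection replaces A <= B by A + 2 <= B, so
    survival leaves exactly B - A in {0, 1}. For a start downward, lowering the barrier by one level
    adds p times a probability of that same form; as each level also shifts the end point by two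
    steps, a barrier at depth e yields a Riemann sum over a range of positions of length 2 e. *)

Definition phi_coeff k (i : nat) : R := (i`!%:R * (i + k)`!%:R)^-1.

(** The modified Bessel function without its prefactor: I_k(y) = (y / 2)^k [phi k] (y^2 / 4). It is
    entire in z, so no square root ever has to be differentiated. *)
Definition phi k z : R := limn (pseries (phi_coeff k) z).

Lemma phi_coeff_ge0 k i : 0 <= phi_coeff k i.
Proof. by rewrite invr_ge0 mulr_ge0. Qed.

Lemma is_cvg_phi k z : cvgn (pseries (phi_coeff k) z).
Proof.
apply: normed_cvg.
apply: (@series_le_cvg _ _ (exp_coeff `|z|)) => [n|n|n|].
- exact: normr_ge0.
- by rewrite exp_coeff_ge0.
- rewrite /exp_coeff /= normrM normrX mulrC ler_wpM2l ?exprn_ge0//.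
  rewrite ger0_norm ?phi_coeff_ge0// /phi_coeff invfM ler_piMr ?invr_ge0//.
  by rewrite invf_le1 ?ltr0n ?fact_gt0// ler1n fact_gt0.
- exact: is_cvg_series_exp_coeff.
Qed.

Lemma pseries_diffs_phi k : pseries_diffs (phi_coeff k) = phi_coeff k.+1.
Proof.
apply/funext => i; rewrite /pseries_diffs /phi_coeff factS natrM -mulrA invfM.
by rewrite mulVKf ?addSnnS.
Qed.

Lemma is_derive_phi k z : is_derive z 1 (phi k) (phi k.+1 z).
Proof.
have := @pseries_snd_diffs R (phi_coeff k) (`|z| + 1) z (@is_cvg_phi k _).
rewrite !pseries_diffs_phi; apply; do ?exact: is_cvg_phi.
by rewrite [ltRHS]ger0_norm ?ltrDl// addr_ge0.
Qed.

Lemma continuous_phi k : continuous (phi k).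
Proof.
move=> z; apply/differentiable_continuous/derivable1_diffP.
exact: (@ex_derive _ _ _ _ _ _ _ (is_derive_phi k z)).
Qed.

Lemma is_derive_phi_comp k f (x df : R) : is_derive x 1 f df ->
  is_derive x 1 (fun y => phi k (f y)) (phi k.+1 (f x) * df).
Proof. by move=> fdf; apply: is_derive1_comp; exact: is_derive_phi. Qed.

(** The three-term recurrence of Bessel functions. It turns the derivative of a Skellam weight into
    a difference of neighbouring weights. *)
Lemma phi_recurrence k z :
  z * phi k.+2 z + k.+1%:R * phi k.+1 z = phi k z.
Proof.
apply/esym; apply: cvg_lim => //.
rewrite -(cvg_shiftS (pseries (phi_coeff k) z)).
rewrite (_ : (fun n => _) = (fun n => z * pseries (phi_coeff k.+2) z n +
   k.+1%:R * pseries (phi_coeff k.+1) z n.+1)); last first.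
  apply/funext => n; rewrite /pseries /series /=; elim: n => [|n IH].
    rewrite !big_nat1 big_geq// mulr0 add0r /phi_coeff !add0n fact0 !mul1r.
    by rewrite expr0 !mulr1 factS natrM invfM mulVKf.
  rewrite big_nat_recr//= IH [in RHS]big_nat_recr//=.
  rewrite [in RHS](big_nat_recr n.+1)//= !mulrDr addrACA; congr (_ + _).
  rewrite /phi_coeff exprS (mulrCA z) !mulrA -mulrDl -mulrDl; congr (_ * _ * _).
  have -> : (n + k.+2 = (n + k).+2)%N by lia.
  have -> : (n.+1 + k.+1 = (n + k).+2)%N by lia.
  have -> : (n.+1 + k = (n + k).+1)%N by lia.
  have := fact_gt0 n; have := fact_gt0 (n + k).
  rewrite -2!(ltr_nat R) !factS !natrM -!natr1 natrD => h1 h2.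
  by field; rewrite !gt_eqF//; apply: lt_le_trans ltr01 _;
    rewrite ?lerDr ?addr_ge0//.
have h := @is_cvg_phi k.+1 z.
apply: cvgD; apply: cvgMr => //; first exact: is_cvg_phi.
by rewrite (cvg_shiftS (pseries _ z)).
Qed.

Lemma phi_ge0 k z : 0 <= z -> 0 <= phi k z.
Proof.
move=> z0; apply: limr_ge; first exact: is_cvg_phi.
apply: nearW => n; apply: sumr_ge0 => i _.
by rewrite mulr_ge0 ?phi_coeff_ge0 ?exprn_ge0.
Qed.

Lemma phi_le k : {in Num.nneg &, {homo phi k : x y / x <= y}}.
Proof.
move=> x y; rewrite !nnegrE => x0 y0 xy.
apply: ler_lim; [exact: is_cvg_phi|exact: is_cvg_phi|].
apply: nearW => n; apply: ler_sum => i _.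
by rewrite ler_wpM2l ?phi_coeff_ge0// lerXn2r.
Qed.

Lemma phi0 k : phi k 0 = k`!%:R^-1.
Proof.
rewrite /phi; apply: cvg_lim => //; rewrite -cvg_shiftS.
rewrite (_ : (fun n => _) = cst (k`!%:R^-1 : R)); first exact: cvg_cst.
apply/funext => n; rewrite /pseries /series /= big_nat_recl//= big1_seq.
  by rewrite addr0 expr0 mulr1 /phi_coeff fact0 mul1r.
by move=> i _; rewrite expr0n /= mulr0.
Qed.

Lemma expn_fact_le_expR n x : 0 <= x -> x ^+ n / n`!%:R <= expR x.
Proof.
move=> x0; case: n => [|n]; first by rewrite fact0 expr0 divr1 -expR0 ler_expR.
by apply: le_trans (expR_ge1Dxn n x0); rewrite lerDr.
Qed.

(** Termwise, u^i / i! * v^(i + k) / (i + k)! is at most u^i / i! * [expR v]. This bounds Skellam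
    weights by 1 without a probability space. *)
Lemma phi_le_expR k u v : 0 <= u -> 0 <= v ->
  v ^+ k * phi k (u * v) <= expR (u + v).
Proof.
move=> u0 v0; have hlim : v ^+ k * pseries (phi_coeff k) (u * v) x @[x --> \oo] -->
    v ^+ k * phi k (u * v) by apply: cvgMl_tmp; exact: is_cvg_phi.
rewrite -(cvg_lim (@Rhausdorff R) hlim).
apply: limr_le; first exact: cvgP hlim.
apply: nearW => n; rewrite expRD /pseries /series /=.
apply: (@le_trans _ _ (\sum_(0 <= i < n) (exp_coeff u i * expR v))).
  rewrite mulr_sumr; apply: ler_sum => i _; rewrite /phi_coeff /exp_coeff /=.
  have := expn_fact_le_expR (i + k) v0.
  move=> /(ler_wpM2l (mulr_ge0 (exprn_ge0 i u0) (_ : 0 <= i`!%:R^-1))) h.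
  apply: le_trans (h _); last by rewrite invr_ge0.
  by rewrite le_eqVlt exprMn exprD invfM; apply/orP; left; apply/eqP; ring.
rewrite -mulr_suml ler_wpM2r ?expR_ge0//.
rewrite [leRHS]/expR.
apply: (nondecreasing_cvgn_le _ (is_cvg_series_exp_coeff u) n).
by apply: nondecreasing_series => i _ _; rewrite exp_coeff_ge0.
Qed.

End Phi.

Section Skellam.
Variable R : realType.
Implicit Types (u v e : R) (k : int).

(* The probability that D - U = k, for independent Poisson variables D and U
   with means v and u. *)
Definition skellam k u v : R :=
  expR (- (u + v)) * match k with
  | Posz n => v ^+ n * phi n (u * v)
  | Negz n => u ^+ n.+1 * phi n.+1 (u * v)
  end.

Lemma skellamC k u v : skellam k u v = skellam (- k) v u.
Proof.
rewrite /skellam (addrC u) (mulrC u).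
by case: k => [[|n]|n].
Qed.

Lemma skellam_ge0 k u v : 0 <= u -> 0 <= v -> 0 <= skellam k u v.
Proof.
move=> u0 v0; rewrite mulr_ge0 ?expR_ge0//.
by case: k => n; rewrite mulr_ge0 ?exprn_ge0 ?phi_ge0// mulr_ge0.
Qed.

Lemma skellam_le1 k u v : 0 <= u -> 0 <= v -> skellam k u v <= 1.
Proof.
move=> u0 v0; rewrite /skellam expRN mulrC ler_pdivrMr ?expR_gt0// mul1r.
case: k => n; first exact: phi_le_expR.
by rewrite (mulrC u) addrC; exact: phi_le_expR.
Qed.

Lemma skellam0 k : skellam k 0 0 = (k == 0)%:R.
Proof.
rewrite /skellam addr0 oppr0 expR0 mul1r.
by case: k => [[|n]|n]; rewrite mulr0 phi0 ?fact0 ?invr1 ?mulr1 ?expr0n ?mul0r.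
Qed.

(** Forward equation of a Poisson variable: raising its mean v by dv adds one to D with probability
    dv. The Lipschitz and Taylor bounds below rest on it, derivatives being differences of numbers
    in [0, 1]. *)
Lemma is_derive_skellamr k u v :
  is_derive v 1 (skellam k u) (skellam (k - 1) u v - skellam k u v).
Proof.
have hexp : is_derive v 1 (fun v => expR (- (u + v))) (- expR (- (u + v))).
  by apply: is_derive_eq; rewrite /GRing.scale/=; ring.
have hphi n : is_derive v 1 (fun v => phi n (u * v)) (phi n.+1 (u * v) * u).
  by apply: is_derive_phi_comp; apply: is_derive_eq; rewrite /GRing.scale/=; ring.
have hpow n : is_derive v 1 (fun v => v ^+ n.+1) (n.+1%:R * v ^+ n).
  apply: DeriveDef; first exact: exprn_derivable.
  by rewrite exp_derive /GRing.scale/= mulr1.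
case: k => [[|n]|n].
- rewrite (_ : skellam 0 u = (fun v => expR (- (u + v))) * (fun v => phi 0 (u * v)));
    last by apply/funext => z; rewrite /skellam /= mul1r.
  apply: (is_derive_eq (is_deriveM hexp (hphi 0%N))).
  rewrite /skellam /= /GRing.scale/= ?expr0 ?expr1 ?mul1r mulrfctE subnn; ring.
- rewrite (_ : skellam n.+1 u = (fun v => expR (- (u + v))) *
    ((fun v => v ^+ n.+1) * (fun v => phi n.+1 (u * v))));
    last by apply/funext => z.
  rewrite (_ : n.+1%:Z - 1 = n%:Z); last by lia.
  apply: (is_derive_eq (is_deriveM hexp (is_deriveM (hpow n) (hphi n.+1)))).
  rewrite /skellam /= /GRing.scale/= ?fctE -(phi_recurrence n) !exprS.
  by ring.
- rewrite (_ : Negz n - 1 = Negz n.+1); last by lia.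
  rewrite (_ : skellam (Negz n) u = (fun v => expR (- (u + v))) *
    ((fun=> u ^+ n.+1) * (fun v => phi n.+1 (u * v))));
    last by apply/funext => z.
  have hc := is_derive_cst (u ^+ n.+1 : R) v (1 : R).
  apply: (is_derive_eq (is_deriveM hexp (is_deriveM hc (hphi n.+1)))).
  by rewrite /skellam /= /GRing.scale/= ?fctE !exprS; ring.
Qed.

Lemma skellam_lipschitzr k u v v' : 0 <= u -> 0 <= v -> 0 <= v' ->
  `|skellam k u v - skellam k u v'| <= `|v - v'|.
Proof.
move=> u0; wlog vv' : v v' / v' <= v => [hw|] v0 v'0.
  have [/hw|/ltW/hw] := leP v' v; first exact.
  by rewrite distrC (distrC v); exact.
have [|x] := MVT_segment vv' (fun x _ => is_derive_skellamr k u x).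
  apply: continuous_subspaceT => x; apply/differentiable_continuous.
  apply/derivable1_diffP.
  exact: (@ex_derive _ _ _ _ _ _ _ (is_derive_skellamr k u x)).
rewrite in_itv/= => /andP[v'x _] ->; rewrite normrM ler_piMl//.
have x0 : 0 <= x by exact: le_trans v'x.
have := skellam_ge0 k u0 x0; have := skellam_le1 k u0 x0.
have := skellam_ge0 (k - 1) u0 x0; have := skellam_le1 (k - 1) u0 x0.
by rewrite ler_norml; lra.
Qed.

Lemma skellam_lipschitz k u v u' v' :
  0 <= u -> 0 <= v -> 0 <= u' -> 0 <= v' ->
  `|skellam k u v - skellam k u' v'| <= `|u - u'| + `|v - v'|.
Proof.
move=> u0 v0 u'0 v'0.
rewrite (le_trans (ler_distD (skellam k u' v) _ _))// lerD//.
  by rewrite 2!(skellamC k _ v) skellam_lipschitzr.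
exact: skellam_lipschitzr.
Qed.

(** Two applications of the mean value theorem; they give C in place of the sharp C / 2. *)
Lemma taylor1_le (f g h : R -> R) (x e C : R) : 0 <= e ->
  (forall z : R, is_derive z 1 f (g z)) ->
  (forall z : R, is_derive z 1 g (h z)) ->
  (forall z, x <= z <= x + e -> `|h z| <= C) ->
  `|f (x + e) - f x - e * g x| <= C * e ^+ 2.
Proof.
move=> e0 fg gh hC.
have cf z : {for z, continuous f}.
  apply/differentiable_continuous/derivable1_diffP.
  exact: (@ex_derive _ _ _ _ _ _ _ (fg z)).
have cg z : {for z, continuous g}.
  apply/differentiable_continuous/derivable1_diffP.
  exact: (@ex_derive _ _ _ _ _ _ _ (gh z)).
have [||y] := @MVT_segment _ f g x (x + e) _ (fun z _ => fg z).
- by rewrite lerDl.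
- by apply: continuous_subspaceT => z; exact: cf.
rewrite in_itv/= => /andP[xy ye] ->.
have [|y'] := @MVT_segment _ g h x y xy (fun z _ => gh z).
  by apply: continuous_subspaceT => z; exact: cg.
rewrite in_itv/= => /andP[xy' y'y] gE.
rewrite (_ : _ - _ = e * (h y' * (y - x))); last by rewrite -gE; ring.
have hy' : `|h y'| <= C by apply: hC; rewrite xy' (le_trans y'y).
rewrite !normrM (ger0_norm e0) mulrCA expr2 ler_pM// ?mulr_ge0//.
by rewrite ler_wpM2l// ger0_norm; lra.
Qed.

(** Replacing a Poisson increment of mean e by a Bernoulli variable of parameter e costs a
    second-order Taylor term; the second derivative in v is a second difference of weights in
    [0, 1], hence bounded by 4. *)
Lemma skellam_stepr k u v e : 0 <= u -> 0 <= v -> 0 <= e ->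
  `|skellam k u (v + e) - ((1 - e) * skellam k u v + e * skellam (k - 1) u v)|
    <= 4 * e ^+ 2.
Proof.
move=> u0 v0 e0.
pose g z := skellam (k - 1) u z - skellam k u z.
pose h z := (skellam (k - 1 - 1) u z - skellam (k - 1) u z) - g z.
have gh (z : R) : is_derive z 1 g (h z).
  by apply: is_deriveB; exact: is_derive_skellamr.
rewrite (_ : _ - _ = skellam k u (v + e) - skellam k u v - e * g v); last first.
  by rewrite /g; ring.
apply: (taylor1_le e0 (is_derive_skellamr k u) gh) => z /andP[vz _].
have z0 : 0 <= z by exact: le_trans vz.
rewrite /h /g.
have := skellam_ge0 k u0 z0; have := skellam_le1 k u0 z0.
have := skellam_ge0 (k - 1) u0 z0; have := skellam_le1 (k - 1) u0 z0.
have := skellam_ge0 (k - 1 - 1) u0 z0; have := skellam_le1 (k - 1 - 1) u0 z0.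
by rewrite ler_norml; lra.
Qed.

Lemma skellam_stepl k u v e : 0 <= u -> 0 <= v -> 0 <= e ->
  `|skellam k (u + e) v - ((1 - e) * skellam k u v + e * skellam (k + 1) u v)|
    <= 4 * e ^+ 2.
Proof.
move=> u0 v0 e0; rewrite 2!(skellamC k) (skellamC (k + 1)).
rewrite (_ : - (k + 1) = - k - 1); last by lia.
exact: skellam_stepr.
Qed.

End Skellam.

(** * Random walks with independent turns *)

Section BernoulliWalk.
Variables (R : realType) (p : R).
Implicit Types (f g : seq bool -> bool) (F : nat -> nat -> R) (v : bool).
Implicit Types (s : seq bool).

(* The probability that f holds of n independent bits, each true with
   probability p. *)
Fixpoint bern n f : R :=
  if n is n'.+1 then
    (1 - p) * bern n' (fun s => f (false :: s)) +
    p * bern n' (fun s => f (true :: s))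
  else (f [::])%:R.

Lemma eq_bern n f g : (forall s, size s = n -> f s = g s) ->
  bern n f = bern n g.
Proof.
elim: n f g => [|n IH] f g fg /=; first by rewrite fg.
by congr (_ * _ + _ * _); apply: IH => s sn; rewrite fg//= sn.
Qed.

Lemma bern_cst n b : bern n (fun=> b) = b%:R.
Proof. by elim: n => //= n ->; ring. Qed.

Lemma bern0 n f : (forall s, size s = n -> f s = false) -> bern n f = 0.
Proof. by move=> f0; rewrite (@eq_bern _ _ (fun=> false)) ?bern_cst. Qed.

Lemma bern_diff n f g :
  bern n (fun s => ~~ g s && f s) = bern n f - bern n (fun s => g s && f s).
Proof.
elim: n f g => [|n IH] f g /=; last by rewrite !IH; ring.
by case: (f _); case: (g _) => /=; ring.
Qed.

(* A path makes a unit step up or down according to its current direction v and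
   then turns if the next bit is true. *)
Fixpoint ups v s : nat := if s is b :: s' then v + ups (v (+) b) s' else 0.

(** Here y is the height above the barrier, in steps. The path may sit on the barrier; only a step
    down from y = 0 kills it. *)
Fixpoint dies v y s : bool :=
  if s is b :: s' then
    if v then dies (~~ b) y.+1 s'
    else if y is y'.+1 then dies b y' s' else true
  else false.

Lemma ups_le_size v s : (ups v s <= size s)%N.
Proof. by elim: s v => //= b s IH v; have := IH (v (+) b); case: v => /=; lia. Qed.

(* The expectation of F (i + A) (j + B) for independent A and B, binomial of
   parameters (a, p) and (b, p). *)
Fixpoint binE F a b i j : R :=
  if b is b'.+1 then (1 - p) * binE F a b' i j + p * binE F a b' i j.+1 else
  (fix binEl a i : R :=
     if a is a'.+1 then (1 - p) * binEl a' i + p * binEl a' i.+1 else F i j) a i.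

Arguments binE : simpl never.

Lemma binESr F a b i j :
  binE F a b.+1 i j = (1 - p) * binE F a b i j + p * binE F a b i j.+1.
Proof. by []. Qed.

Lemma binESl F a b i j :
  binE F a.+1 b i j = (1 - p) * binE F a b i j + p * binE F a b i.+1 j.
Proof. by elim: b i j => // b IH i j; rewrite !binESr !IH; ring. Qed.

Lemma binE_shift F i0 j0 a b i j :
  binE (fun i j => F (i + i0)%N (j + j0)%N) a b i j =
  binE F a b (i + i0)%N (j + j0)%N.
Proof.
elim: b i j => [|b IH] i j; last by rewrite !binESr !IH.
by elim: a i => // a IH i; rewrite !binESl !IH.
Qed.

Lemma eq_binE F1 F2 a b i j : F1 =2 F2 -> binE F1 a b i j = binE F2 a b i j.
Proof.
move=> eqF; elim: b i j => [|b IH] i j; last by rewrite !binESr !IH.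
by elim: a i => // a IH i; rewrite !binESl !IH.
Qed.

Lemma binEB F1 F2 a b i j : binE (fun i j => F1 i j - F2 i j) a b i j =
  binE F1 a b i j - binE F2 a b i j.
Proof.
elim: b i j => [|b IH] i j; last by rewrite !binESr !IH; ring.
by elim: a i => // a IH i; rewrite !binESl !IH; ring.
Qed.

Hypothesis p01 : 0 <= p <= 1.

Lemma binE_bounds F m M a b i j : (forall i j, m <= F i j <= M) ->
  m <= binE F a b i j <= M.
Proof.
move=> F1; have /andP[p0 p1] := p01; have q0 : 0 <= 1 - p by lra.
elim: b i j => [|b IH] i j; last first.
  have /andP[l0 l1] := IH i j; have /andP[h0 h1] := IH i j.+1.
  rewrite binESr; apply/andP; split.
    by apply: le_trans (lerD (ler_wpM2l q0 l0) (ler_wpM2l p0 h0)); lra.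
  by apply: le_trans (lerD (ler_wpM2l q0 l1) (ler_wpM2l p0 h1)) _; lra.
elim: a i => // a IH i.
have /andP[l0 l1] := IH i; have /andP[h0 h1] := IH i.+1.
rewrite binESl; apply/andP; split.
  by apply: le_trans (lerD (ler_wpM2l q0 l0) (ler_wpM2l p0 h0)); lra.
by apply: le_trans (lerD (ler_wpM2l q0 l1) (ler_wpM2l p0 h1)) _; lra.
Qed.

Definition leF i j : R := (i <= j)%N%:R.
Definition eqF i j : R := (i == j)%:R + (i.+1 == j)%:R.

Lemma binE_leFSS a b i j : binE leF a b i.+1 j.+1 = binE leF a b i j.
Proof.
by rewrite -(addn1 i) -(addn1 j) -binE_shift; apply: eq_binE => k l;
  rewrite /leF leq_add2r.
Qed.

Lemma binE_leF_gt0 a i : binE leF a 0 i.+1 0 = 0.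
Proof. by elim: a i => // a IH i; rewrite binESl !IH; ring. Qed.

Lemma binE_leF0 b j : binE leF 0 b 0 j = 1.
Proof. by elim: b j => // b IH j; rewrite binESr !IH; ring. Qed.

(** Among the pairs with A <= B, those with A + 2 <= B are removed, and B - A = 0 or 1 remains. The
    sum of I_0 and I_1 in [p_minus] originates here. *)
Lemma binE_eqF a b :
  binE leF a b 0 0 - binE leF a b 2 0 = binE eqF a b 0 0.
Proof.
have -> : binE leF a b 2 0 =
    binE (fun i j => leF (i + 2)%N (j + 0)%N) a b 0 0 by rewrite binE_shift.
rewrite -binEB.
apply: eq_binE => i j; rewrite /leF /eqF.
have [->|ij] := eqVneq i j.
  rewrite leqnn addn0 addn2 (_ : (j.+2 <= j)%N = false) ?subr0; last by lia.
  by rewrite (_ : (j.+1 == j) = false) ?addr0//; lia.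
have [<-|ij1] := eqVneq i.+1 j.
  by rewrite addn0 addn2 ltnn leqnSn subr0 add0r.
by rewrite addn0 (_ : (i + 2 <= j)%N = (i <= j)%N) ?subrr ?add0r//; lia.
Qed.

(* The path makes a + 1 steps up before b + 1 steps down.  The decisions taken
   after the first a steps up and those taken after the first b steps down are
   independent; with an initial step up it happens iff the second kind contains
   at least as many turns as the first, with an initial step down iff it contains
   more. *)
Lemma bern_ups a b :
  bern (a.+1 + b) (fun s => a.+1 <= ups false s)%N = binE leF a b 1 0 /\
  bern (a.+1 + b) (fun s => a.+1 <= ups true s)%N = binE leF a b 0 0.
Proof.
move: {2}(a + b)%N (erefl (a + b)%N) => n; elim: n a b => [|n IH] a b abn.
  have [-> ->] : a = 0%N /\ b = 0%N by lia.
  by split; rewrite /binE /leF /=; ring.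
split.
- case: b abn => [|b] abn.
    rewrite binE_leF_gt0 bern0// => -[//|c s] /=; rewrite addn0 => -[sa].
    by have := ups_le_size c s; rewrite sa add0n; lia.
  (* The first bit is one of the trials after steps down. If it is a turn, both counters shift by
     one and the remaining path starts upward. *)
  rewrite binESr binE_leFSS addnS /=.
  by have [h1 h2] := IH a b ltac:(lia); rewrite -h1 -h2 addSn /=.
- case: a abn => [|a] abn.
    rewrite (@eq_bern _ _ (fun=> true)) ?bern_cst ?binE_leF0//.
    by case.
  rewrite binESl addSn /=.
  have [h1 h2] := IH a b ltac:(lia).
  by rewrite -h1 -h2 /= ?add1n /=.
Qed.

(* Reflection principle: shifting the target by twice the height y of the
   starting point over the barrier, the first path to the barrier can be
   exchanged with the first return to it. *)
Lemma bern_dies v a b y : (b <= a + y)%N ->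
  bern (a + b) (fun s => dies v y s && (a <= ups v s)%N) =
  binE leF (a + y).-1 (b - y) (if v then 2 else 1) 0.
Proof.
move: {2}(a + b)%N (erefl (a + b)%N) => n; elim: n v a b y => [|n IH] v a b y.
  move=> abn _; have [-> ->] : a = 0%N /\ b = 0%N by lia.
  by rewrite sub0n /=; case: v; rewrite binE_leF_gt0.
case: v => abn bay.
- case: a abn bay => [|a] abn bay.
    case: b abn bay => [|b] abn bay; first by lia.
    rewrite (_ : (b.+1 - y = 0)%N); last by lia.
    rewrite binE_leF_gt0 add0n /=.
    have := IH true 0%N b y.+1 ltac:(lia) ltac:(lia).
    have := IH false 0%N b y.+1 ltac:(lia) ltac:(lia).
    rewrite !add0n (_ : (b - y.+1 = 0)%N); last by lia.
    by rewrite !binE_leF_gt0 => -> ->; ring.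
  rewrite addSn /= ?add1n /=.
  have := IH true a b y.+1 ltac:(lia) ltac:(lia).
  have := IH false a b y.+1 ltac:(lia) ltac:(lia).
  rewrite addnS /= => -> ->.
  have [yb|yb] := ltnP y b; last first.
    rewrite (_ : (b - y.+1 = 0)%N); last by lia.
    rewrite (_ : (b - y = 0)%N); last by lia.
    by rewrite !binE_leF_gt0; ring.
  rewrite (_ : (b - y = (b - y.+1).+1)%N); last by lia.
  by rewrite binESr binE_leFSS.
(* At y = 0 a downward start dies at once, so the count becomes the unrestricted one of
   [bern_ups]. *)
- case: y bay => [|y] bay.
    case: a abn bay => [|a] abn bay; first by lia.
    rewrite addn0 subn0; have [h _] := bern_ups a b.
    by apply: etrans h; apply: eq_bern => -[].
  case: b abn bay => [|b] abn bay.
    rewrite sub0n binE_leF_gt0 bern0// => -[//|c s] sa.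
    apply/negbTE; rewrite negb_and; apply/orP; right.
    by have := ups_le_size c s; move: sa => /=; rewrite add0n; lia.
  rewrite addnS /= ?add0n.
  have := IH true a b y ltac:(lia) ltac:(lia).
  have := IH false a b y ltac:(lia) ltac:(lia).
  move=> -> ->; rewrite subSS addnS /=.
  case E : (a + y)%N => [|m] /=; last by rewrite binESl.
  rewrite (_ : (b - y = 0)%N); last by lia.
  by rewrite !binE_leF_gt0; ring.
Qed.

Lemma bern_survives_up a b : (b <= a.+1)%N ->
  bern (a.+1 + b) (fun s => ~~ dies true 0 s && (a.+1 <= ups true s)%N) =
  binE eqF a b 0 0.
Proof.
move=> ba; rewrite bern_diff bern_dies ?addn0// subn0.
by have [_ ->] := bern_ups a b; rewrite -binE_eqF.
Qed.

(** Each further level of depth moves one trial from B to A, which matters only when that trial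
    succeeds, so it adds at most p. The bound serves for a barrier slightly below 0, where the grid
    error puts it. *)
Lemma bern_survives_up_le a b y : (b <= a.+1 + y)%N ->
  bern (a.+1 + b) (fun s => ~~ dies true y s && (a.+1 <= ups true s)%N) <=
  binE eqF a b 0 0 + p * y%:R.
Proof.
move=> bay; rewrite bern_diff bern_dies//.
have [_ ->] := bern_ups a b; rewrite -binE_eqF.
suff : binE leF a b 2 0 - binE leF (a + y) (b - y) 2 0 <= p * y%:R by lra.
have /andP[p0 p1] := p01.
elim: y {bay} => [|y IH]; first by rewrite addn0 subn0 subrr mulr0.
suff : binE leF (a + y) (b - y) 2 0 - binE leF (a + y.+1) (b - y.+1) 2 0 <= p.
  by move=> h; rewrite -natr1; lra.
have [yb|yb] := ltnP y b; last first.
  have [-> ->] : (b - y = 0)%N /\ (b - y.+1 = 0)%N by lia.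
  by rewrite !binE_leF_gt0 subrr.
rewrite (_ : (b - y = (b - y.+1).+1)%N); last by lia.
rewrite addnS binESr binESl; set x := binE _ _ _ _ _; set z := binE _ _ _ 2 1.
set z' := binE _ _ _ 3 0.
have lb k l : 0 <= leF k l <= 1 by rewrite /leF; case: leqP; rewrite ?lexx ?ler01.
have /andP[zl zr] : 0 <= z <= 1 by exact: binE_bounds.
have /andP[z'l z'r] : 0 <= z' <= 1 by exact: binE_bounds.
have := mulr_ge0 p0 z'l; have := ler_wpM2l p0 zr; lra.
Qed.

(** Conditioning on the trial moved from B to A when the barrier drops by one level leaves p times
    the difference of [binE_eqF]; the sum over levels telescopes. *)
Lemma bern_survives_down a b y : (b <= a.+1 + y)%N -> (y <= b)%N ->
  bern (a.+1 + b) (fun s => ~~ dies false y s && (a.+1 <= ups false s)%N) =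
  p * \sum_(i < y) binE eqF (a + i) (b - i.+1) 0 0.
Proof.
move=> bay yb; rewrite bern_diff bern_dies//.
have [-> _] := bern_ups a b.
elim: y {bay} yb => [|y IH] yb.
  by rewrite addn0 subn0 subrr big_ord0 mulr0.
rewrite big_ord_recr /= mulrDr -IH; last by lia.
rewrite (_ : (b - y = (b - y.+1).+1)%N); last by lia.
by rewrite addnS binESr binESl binE_leFSS -binE_eqF; ring.
Qed.

(** A path with at least a + 1 steps up has at most b steps down, so a barrier b or more levels
    below its start cannot kill it. *)
Lemma bern_survives_down_le a b y : (b <= y)%N ->
  bern (a.+1 + b) (fun s => ~~ dies false y s && (a.+1 <= ups false s)%N) =
  bern (a.+1 + b) (fun s => ~~ dies false b s && (a.+1 <= ups false s)%N).
Proof.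
move=> b_y; rewrite !bern_diff !bern_dies; [|lia..].
rewrite (_ : (b - y = 0)%N); last by lia.
by rewrite subnn !binE_leF_gt0.
Qed.

End BernoulliWalk.

(** * Poisson approximation *)

Section SkellamApprox.
Variables (R : realType).
Implicit Types (p u v w x mu L eta : R) (a b y n : nat).

(* On the line u + v = L, twice c / lam times the density p_minus. *)
Definition sk01 L w : R := skellam 0 w (L - w) + skellam 1 w (L - w).

Lemma sk01E L w : sk01 L w =
  expR (- L) * (phi 0 (w * (L - w)) + (L - w) * phi 1 (w * (L - w))).
Proof.
by rewrite /sk01 /skellam /= ?expr0 ?expr1 ?mul1r -mulrDr; congr (expR (- _) * _); ring.
Qed.

Definition dsk01 L w : R := expR (- L) *
  ((L - 2 * w - 1) * phi 1 (w * (L - w)) +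
   (L - w) * (L - 2 * w) * phi 2 (w * (L - w))).

Lemma is_derive_sk01 L w : is_derive w 1 (sk01 L) (dsk01 L w).
Proof.
have hw : is_derive w 1 (fun w => w * (L - w)) (L - 2 * w).
  by apply: is_derive_eq; rewrite /GRing.scale/=; ring.
have hL : is_derive w 1 (fun w => L - w) (- 1).
  by apply: is_derive_eq; rewrite /GRing.scale/=; ring.
have h0 := is_derive_phi_comp 0 hw; have h1 := is_derive_phi_comp 1 hw.
have hc := is_derive_cst (expR (- L) : R) w (1 : R).
rewrite (_ : sk01 L = (fun=> expR (- L)) * ((fun w => phi 0 (w * (L - w))) +
  (fun w => L - w) * (fun w => phi 1 (w * (L - w))))); last first.
  by apply/funext => z; rewrite sk01E.
apply: (is_derive_eq (is_deriveM hc (is_deriveD h0 (is_deriveM hL h1)))).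
by rewrite /dsk01 /GRing.scale/= ?fctE; ring.
Qed.

Lemma continuous_sk01 L : continuous (sk01 L).
Proof.
move=> w; apply/differentiable_continuous/derivable1_diffP.
exact: (@ex_derive _ _ _ _ _ _ _ (is_derive_sk01 L w)).
Qed.

Lemma continuous_dsk01 L : continuous (dsk01 L).
Proof.
move=> w; rewrite /dsk01.
have h k : {for w, continuous (fun w => phi k (w * (L - w)))}.
  apply: (@continuous_comp _ _ _ (fun w => w * (L - w)) (phi k)).
    apply: continuousM; first exact: cvg_id.
    by apply: continuousB; [exact: cvg_cst|exact: cvg_id].
  exact: continuous_phi.
have hL : {for w, continuous (fun w => L - w)}.
  by apply: continuousB; [exact: cvg_cst|exact: cvg_id].
have h2 : {for w, continuous (fun w => L - 2 * w)}.
  apply: continuousB; first exact: cvg_cst.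
  by apply: continuousM; [exact: cvg_cst|exact: cvg_id].
apply: cvgM; first exact: cvg_cst.
apply: cvgD; apply: cvgM; [|exact: h| |exact: h].
  by apply: cvgB; [exact: h2|exact: cvg_cst].
by apply: cvgM; [exact: hL|exact: h2].
Qed.

Lemma sk01_ge0 L w : 0 <= w <= L -> 0 <= sk01 L w.
Proof. by move=> /andP[? ?]; rewrite addr_ge0// skellam_ge0//; lra. Qed.

Lemma sk01_le2 L w : 0 <= w <= L -> sk01 L w <= 2.
Proof.
move=> /andP[w0 wL]; have Lw : 0 <= L - w by lra.
have := @skellam_le1 _ 0 _ _ w0 Lw; have := @skellam_le1 _ 1 _ _ w0 Lw.
by rewrite /sk01; lra.
Qed.

Lemma sk01_lipschitz L w w' : 0 <= w <= L -> 0 <= w' <= L ->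
  `|sk01 L w - sk01 L w'| <= 4 * `|w - w'|.
Proof.
move=> /andP[w0 wL] /andP[w'0 w'L].
have Lw : 0 <= L - w by lra.
have Lw' : 0 <= L - w' by lra.
have := skellam_lipschitz 0 w0 Lw w'0 Lw'.
have := skellam_lipschitz 1 w0 Lw w'0 Lw'.
rewrite (_ : L - w - (L - w') = - (w - w')) ?normrN; last by ring.
rewrite /sk01 => h1 h0.
rewrite (_ : _ - _ = (skellam 0 w (L - w) - skellam 0 w' (L - w')) +
  (skellam 1 w (L - w) - skellam 1 w' (L - w'))); last by ring.
by apply: le_trans (ler_normD _ _) _; lra.
Qed.

(** Beyond L / 2 both w (L - w) and L - w decrease, and [phi] is nondecreasing on nonnegative
    arguments. This and [sk01_flip_le] yield the sign of the conditional density. *)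
Lemma sk01_le L w w' : L / 2 <= w -> w <= w' -> w' <= L ->
  sk01 L w' <= sk01 L w.
Proof.
move=> Lw ww' w'L; rewrite !sk01E ler_wpM2l ?expR_ge0//.
have h : w' * (L - w') <= w * (L - w).
  rewrite -subr_ge0 (_ : _ - _ = (w' - w) * (w' + w - L)); last by ring.
  by rewrite mulr_ge0; lra.
have h0 : 0 <= w' * (L - w') by rewrite mulr_ge0; lra.
have h0' := le_trans h0 h.
apply: lerD; first by apply: phi_le.
by apply: ler_pM; rewrite ?phi_ge0//; [lra|lra|apply: phi_le].
Qed.

(** The arguments of [phi] are invariant under w -> L - w; only the factor of [phi 1] changes, from
    L - w to the larger w. *)
Lemma sk01_flip_le L w : L / 2 <= w -> w <= L -> sk01 L w <= sk01 L (L - w).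
Proof.
move=> Lw wL; rewrite !sk01E ler_wpM2l ?expR_ge0//.
rewrite (_ : L - (L - w) = w) ?(mulrC (L - w) w); last by ring.
rewrite lerD2l ler_wpM2r//; last by lra.
by rewrite phi_ge0// mulr_ge0//; lra.
Qed.

Lemma sk01_gt0 L w : 0 <= w <= L -> 0 < sk01 L w.
Proof.
move=> /andP[w0 wL]; rewrite sk01E mulr_gt0 ?expR_gt0//.
have h : 0 <= w * (L - w) by rewrite mulr_ge0//; lra.
rewrite ltr_wpDr//; first by rewrite mulr_ge0 ?phi_ge0//; lra.
apply: lt_le_trans (phi_le 0 _ _ h); rewrite ?nnegrE//.
by rewrite phi0 fact0 invr1.
Qed.

(** The a + b trials are exchanged one at a time for Poisson increments of mean p, each at a cost of
    4 p^2 for each of the two Skellam weights. *)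
Lemma binE_skellam p a b i j : 0 <= p <= 1 ->
  `|binE p (@eqF R) a b i j - (skellam (i%:Z - j%:Z) (p * a%:R) (p * b%:R) +
      skellam (i%:Z - j%:Z + 1) (p * a%:R) (p * b%:R))|
    <= 8 * p ^+ 2 * (a + b)%:R.
Proof.
move=> /andP[p0 p1]; have q0 : 0 <= 1 - p by lra.
elim: b i j => [|b IH] i j.
  elim: a i => [|a IH] i.
    rewrite /binE !mulr0 !skellam0 /eqF.
    rewrite (_ : (i%:Z - j%:Z == 0) = (i == j)); last by lia.
    rewrite (_ : (i%:Z - j%:Z + 1 == 0) = (i.+1 == j)); last by lia.
    by rewrite subrr normr0.
  rewrite binESl -(natr1 a) mulrDr mulr1.
  have pa : 0 <= p * a%:R by rewrite mulr_ge0.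
  have pb : 0 <= p * 0%:R :> R by rewrite mulr0.
  have t1 := skellam_stepl (i%:Z - j%:Z) pa pb p0.
  have t2 := skellam_stepl (i%:Z - j%:Z + 1) pa pb p0.
  have := IH i; have := IH i.+1.
  rewrite (_ : i.+1%:Z - j%:Z = i%:Z - j%:Z + 1); last by lia.
  rewrite addSn -(natr1 (a + 0)).
  move: t1 t2; rewrite !ler_norml => /andP[? ?] /andP[? ?] /andP[? ?] /andP[? ?].
  by apply/andP; split; nra.
rewrite binESr -(natr1 b) mulrDr mulr1.
have pa : 0 <= p * a%:R by rewrite mulr_ge0.
have pb : 0 <= p * b%:R by rewrite mulr_ge0.
have t1 := skellam_stepr (i%:Z - j%:Z) pa pb p0.
have t2 := skellam_stepr (i%:Z - j%:Z + 1) pa pb p0.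
have := IH i j; have := IH i j.+1.
rewrite (_ : i%:Z - j.+1%:Z = i%:Z - j%:Z - 1); last by lia.
move: t2; rewrite addrK => t2; rewrite subrK.
rewrite addnS -(natr1 (a + b)).
move: t1 t2; rewrite !ler_norml => /andP[? ?] /andP[? ?] /andP[? ?] /andP[? ?].
by apply/andP; split; nra.
Qed.

(** Since a mu and b mu are at most L, the Poisson approximation costs 16 L mu. The remaining 4 (L +
    1) mu comes from two Skellam weights with two means each, every mean being off by at most (L +
    1) mu. *)
Lemma binE_sk01 p mu L w a b n : 0 <= p <= 1 -> 0 <= mu -> mu - mu ^+ 2 <= p <= mu ->
  n%:R * mu = L -> (a <= n)%N -> (b <= n)%N -> 0 <= w <= L ->
  `|a%:R * mu - w| <= mu -> `|b%:R * mu - (L - w)| <= mu ->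
  `|binE p (@eqF R) a b 0 0 - sk01 L w| <= (20 * L + 4) * mu.
Proof.
move=> p01 mu0 /andP[pl pr] nL an bn /andP[w0 wL] aw bw.
have /andP[p0 p1] := p01.
have := binE_skellam a b 0 0 p01; rewrite subrr add0r => h.
have pa : 0 <= p * a%:R by rewrite mulr_ge0.
have pb : 0 <= p * b%:R by rewrite mulr_ge0.
have Lw : 0 <= L - w by lra.
have an' : a%:R * mu <= L by rewrite -nL ler_wpM2r// ler_nat.
have bn' : b%:R * mu <= L by rewrite -nL ler_wpM2r// ler_nat.
have a0 : 0 <= a%:R :> R by [].
have b0 : 0 <= b%:R :> R by [].
have pmu k : 0 <= k%:R * mu <= L -> `|p * k%:R - k%:R * mu| <= L * mu.
  move=> /andP[k0 kL]; rewrite (_ : _ - _ = - (k%:R * (mu - p))); last by ring.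
  rewrite normrN ger0_norm; last by rewrite mulr_ge0//; lra.
  have : k%:R * (mu - p) <= k%:R * mu ^+ 2 by rewrite ler_wpM2l//; lra.
  by move/le_trans; apply; rewrite expr2 mulrA ler_wpM2r.
have da : `|p * a%:R - w| <= (L + 1) * mu.
  apply: le_trans (ler_distD (a%:R * mu) _ _) _.
  have := pmu a; rewrite mulr_ge0// an' => /(_ isT); lra.
have db : `|p * b%:R - (L - w)| <= (L + 1) * mu.
  apply: le_trans (ler_distD (b%:R * mu) _ _) _.
  have := pmu b; rewrite mulr_ge0// bn' => /(_ isT); lra.
have l0 := skellam_lipschitz 0 pa pb w0 Lw.
have l1 := skellam_lipschitz 1 pa pb w0 Lw.
have hp : 8 * p ^+ 2 * (a + b)%:R <= 16 * L * mu.
  have : p ^+ 2 <= mu ^+ 2 by rewrite lerXn2r// nnegrE.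
  rewrite natrD => p2.
  have : p ^+ 2 * (a%:R + b%:R) <= mu ^+ 2 * (a%:R + b%:R).
    by rewrite ler_wpM2r// addr_ge0.
  by nra.
rewrite /sk01; move: h l0 l1.
set r := binE _ _ _ _ _ _; set s0 := skellam 0 _ _; set s1 := skellam 1 _ _.
set z0 := skellam 0 _ _; set z1 := skellam 1 _ _.
move=> h l0 l1.
rewrite (_ : r - (z0 + z1) = (r - (s0 + s1)) + ((s0 - z0) + (s1 - z1))); last by ring.
apply: le_trans (ler_normD _ _) _.
have := ler_normD (s0 - z0) (s1 - z1); lra.
Qed.

Variables (L : R) (J : R -> R).
Hypothesis derJ : forall z, 0 <= z <= L -> is_derive z 1 J (sk01 L z).

Lemma J_mvt w w' : 0 <= w -> w <= w' -> w' <= L ->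
  exists2 z, w <= z <= w' & J w' - J w = sk01 L z * (w' - w).
Proof.
move=> w0 ww' w'L.
have [||z] := @MVT_segment _ J (sk01 L) w w' ww'.
- by move=> x; rewrite in_itv/= => /andP[? ?]; apply: derJ; lra.
- apply: derivable_within_continuous => x; rewrite in_itv/= => /andP[? ?].
  by have [] := derJ (z := x) ltac:(lra).
by rewrite in_itv/= => zww' ->; exists z.
Qed.

Lemma J_lipschitz w w' : 0 <= w <= L -> 0 <= w' <= L ->
  `|J w - J w'| <= 2 * `|w - w'|.
Proof.
wlog ww' : w w' / w' <= w => [hw|] wL w'L.
  have [|/ltW] := leP w' w; first by move/hw; exact.
  by move=> /hw h; rewrite distrC (distrC w) h.
have [z /andP[z1 z2] ->] := J_mvt (w := w') ltac:(lra) ww' ltac:(lra).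
rewrite normrM ler_wpM2r// ger0_norm; first by apply: sk01_le2; lra.
by apply: sk01_ge0; lra.
Qed.

Variables (p mu : R) (n : nat).
Hypotheses (p01 : 0 <= p <= 1) (mu0 : 0 <= mu) (pmu : mu - mu ^+ 2 <= p <= mu).
Hypothesis nL : n%:R * mu = L.

(** Each term costs (20 L + 4) mu^2 for the Poisson approximation, 4 mu^2 for moving [sk01] to the
    mean value point and 2 mu^2 for having p instead of mu. There are y terms, and y mu <= L. *)
Lemma riemann_sk01 a b y : (a.+1 + b = n)%N -> (y <= b)%N ->
  `|p * \sum_(i < y) binE p (@eqF R) (a + i) (b - i.+1) 0 0 -
    (J ((a.+1 + y)%:R * mu) - J (a.+1%:R * mu))| <= L * (20 * L + 10) * mu.
Proof.
move=> abn yb; have L0 : 0 <= L by rewrite -nL mulr_ge0.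
suff : `|p * \sum_(i < y) binE p (@eqF R) (a + i) (b - i.+1) 0 0 -
    (J ((a.+1 + y)%:R * mu) - J (a.+1%:R * mu))| <= y%:R * ((20 * L + 10) * mu ^+ 2).
  move/le_trans; apply.
  rewrite (_ : _ * (_ * mu ^+ 2) = (y%:R * mu) * ((20 * L + 10) * mu)); last by ring.
  rewrite -[leRHS]mulrA ler_wpM2r//; first by rewrite mulr_ge0//; lra.
  by rewrite -nL ler_wpM2r// ler_nat; lia.
have wle k : (k <= n)%N -> 0 <= k%:R * mu <= L.
  by move=> kn; rewrite mulr_ge0//= -nL ler_wpM2r// ler_nat.
elim: y yb => [|y IH] yb.
  by rewrite big_ord0 mulr0 addn0 subrr subrr normr0 mul0r.
have [ha hb hy1 hy2] : [/\ (a + y <= n)%N, (b - y.+1 <= n)%N, (a.+1 + y <= n)%N &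
    (a.+1 + y.+1 <= n)%N] by clear -abn yb; split; lia.
have {}IH := IH (ltnW yb); rewrite big_ord_recr /= mulrDr.
set S := p * _ in IH *; set r := binE _ _ _ _ _ _.
set w := (a.+1 + y)%:R * mu in IH *.
have /andP[w0 wL] : 0 <= w <= L by apply: wle.
have /andP[w0' wL'] : 0 <= (a.+1 + y.+1)%:R * mu <= L by apply: wle.
have wS : (a.+1 + y.+1)%:R * mu = w + mu by rewrite /w addnS -natr1; ring.
rewrite wS in w0' wL' *.
have wwmu : w <= w + mu by rewrite lerDl.
have [z /andP[z1 z2] Jz] := J_mvt w0 wwmu wL'.
have rw : `|r - sk01 L w| <= (20 * L + 4) * mu.
  apply: (binE_sk01 p01 mu0 pmu nL); [by []|by []|by rewrite w0| |].
    rewrite (_ : _ - _ = - mu) ?normrN ?ger0_norm//.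
    by rewrite /w addSn -natr1; ring.
  rewrite -nL -abn /w -[in (a.+1 + b)%:R](subnK yb).
  rewrite (_ : _ - _ = - mu) ?normrN ?ger0_norm//.
  by rewrite !natrD -!natr1; ring.
have r2 : 0 <= r <= 2.
  apply: binE_bounds => // i j; rewrite /eqF -natrD ler0n ler_nat.
  by case: (i == j); case: (i.+1 == j).
have zw := @sk01_lipschitz L z w ltac:(lra) ltac:(lra).
have {}zw : `|sk01 L z - sk01 L w| <= 4 * mu.
  by apply: le_trans zw _; rewrite ger0_norm; lra.
rewrite (_ : _ - _ = (S - (J w - J (a.+1%:R * mu))) + (p * r - (J (w + mu) - J w)));
  last by ring.
apply: le_trans (ler_normD _ _) _.
rewrite -(natr1 y) mulrDl mul1r; apply: lerD => //; rewrite Jz.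
rewrite (_ : _ - _ = - ((mu - p) * r) + mu * ((r - sk01 L w) - (sk01 L z - sk01 L w)));
  last by ring.
apply: le_trans (ler_normD _ _) _.
have /andP[pl pr] := pmu; have /andP[r0 r2'] := r2.
have h1 : `|- ((mu - p) * r)| <= mu ^+ 2 * 2.
  by rewrite normrN normrM (ger0_norm r0) ger0_norm ?ler_pM//; lra.
have h2 : `|mu * ((r - sk01 L w) - (sk01 L z - sk01 L w))| <= (20 * L + 8) * mu ^+ 2.
  rewrite normrM (ger0_norm mu0) expr2 [leRHS]mulrCA ler_wpM2l//.
  by apply: le_trans (ler_normB _ _) _; lra.
by lra.
Qed.

(** The extra 6 mu is the Lipschitz constant 2 of [J] times the rounding errors, mu at the lower end
    and 2 mu at the upper end. *)
Lemma survives_down_approx a b y w eta : (a.+1 + b = n)%N -> (b <= a.+1 + y)%N ->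
  0 <= w <= L -> 0 <= eta -> a%:R * mu <= w <= a.+1%:R * mu ->
  y%:R * mu <= eta <= y.+1%:R * mu ->
  `|bern p n (fun s => ~~ dies false y s && (a.+1 <= ups false s)%N) -
    (J (Num.min (w + eta) L) - J w)| <= (L * (20 * L + 10) + 6) * mu.
Proof.
move=> abn bay /andP[w0 wL] eta0 /andP[aw wa] /andP[ye ey].
have nmu : (a.+1 + b)%:R * mu = L by rewrite abn.
have hA : (a.+1)%:R * mu <= L.
  by rewrite -nmu ler_wpM2r// ler_nat leq_addr.
have aS : a.+1%:R * mu = a%:R * mu + mu by rewrite -natr1; ring.
have yS : y.+1%:R * mu = y%:R * mu + mu by rewrite -natr1; ring.
(* Discrete counterpart of the truncation at L: deepening the barrier beyond b levels changes
   nothing. *)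
pose m := minn y b.
have bernE : bern p n (fun s => ~~ dies false y s && (a.+1 <= ups false s)%N) =
  p * \sum_(i < m) binE p (@eqF R) (a + i) (b - i.+1) 0 0.
  rewrite -abn /m; case: (leqP y b) => yb.
    exact: (bern_survives_down p01 bay yb).
  apply: etrans (bern_survives_down_le p01 _ (ltnW yb)) _.
  by apply: (bern_survives_down p01); rewrite ?leq_addl.
have mb : (m <= b)%N by exact: geq_minr.
have := riemann_sk01 abn mb; rewrite -bernE.
set B := bern _ _ _ => hB.
have hw : 0 <= a.+1%:R * mu <= L by rewrite mulr_ge0.
have hm : 0 <= (a.+1 + m)%:R * mu <= L.
  by rewrite mulr_ge0//= -nmu ler_wpM2r// ler_nat leq_add2l.
have hmin : 0 <= Num.min (w + eta) L <= L.
  by rewrite ge_min lexx orbT andbT le_min; apply/andP; split; lra.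
have l1 := J_lipschitz hw (w' := w) ltac:(lra).
have l2 := J_lipschitz hm hmin.
have d1 : `|a.+1%:R * mu - w| <= mu by rewrite ger0_norm; lra.
have d2 : `|(a.+1 + m)%:R * mu - Num.min (w + eta) L| <= 2 * mu.
  rewrite /m; case: (leqP y b) => yb.
    have hy : (a.+1 + y)%:R * mu = a%:R * mu + mu + y%:R * mu by rewrite natrD; lra.
    have hy' : (a.+1 + y)%:R * mu <= L by rewrite -nmu ler_wpM2r// ler_nat leq_add2l.
    by rewrite hy in hy' *; rewrite ler_norml; case: (leP (w + eta) L) => ?; lra.
  rewrite nmu; case: (leP (w + eta) L) => ?; last by rewrite subrr normr0; lra.
  have hy : b.+1%:R * mu <= y%:R * mu by rewrite ler_wpM2r// ler_nat.
  move: nmu hy; rewrite natrD -!natr1 !mulrDl !mul1r => ? ?.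
  by rewrite ger0_norm; lra.
rewrite (_ : B - (J (Num.min (w + eta) L) - J w) =
  (B - (J ((a.+1 + m)%:R * mu) - J (a.+1%:R * mu))) +
  ((J ((a.+1 + m)%:R * mu) - J (Num.min (w + eta) L)) - (J (a.+1%:R * mu) - J w)));
  last by ring.
apply: le_trans (ler_normD _ _) _.
have := ler_normB (J ((a.+1 + m)%:R * mu) - J (Num.min (w + eta) L))
  (J (a.+1%:R * mu) - J w).
lra.
Qed.

Lemma binE_sk01_approx a b w : (a.+1 + b = n)%N ->
  0 <= w <= L -> a%:R * mu <= w <= a.+1%:R * mu ->
  `|binE p (@eqF R) a b 0 0 - sk01 L w| <= (20 * L + 4) * mu.
Proof.
move=> abn wL /andP[aw wa].
have aS : a.+1%:R * mu = a%:R * mu + mu by rewrite -natr1; ring.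
apply: (binE_sk01 p01 mu0 pmu nL) => //; [lia|lia| |].
  by rewrite ler_norml; lra.
move: nL; rewrite -abn natrD mulrDl aS => <-.
by rewrite ler_norml; lra.
Qed.

Lemma survives_up_approx a b w : (a.+1 + b = n)%N -> (b <= a.+1)%N ->
  0 <= w <= L -> a%:R * mu <= w <= a.+1%:R * mu ->
  `|bern p n (fun s => ~~ dies true 0 s && (a.+1 <= ups true s)%N) -
    sk01 L w| <= (20 * L + 4) * mu.
Proof.
move=> abn ba wL aw; rewrite -abn bern_survives_up//.
exact: binE_sk01_approx.
Qed.

Lemma survives_up_approx_le a b y w eta : (a.+1 + b = n)%N ->
  (b <= a.+1 + y)%N ->
  0 <= w <= L -> a%:R * mu <= w <= a.+1%:R * mu -> y%:R * mu <= eta ->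
  bern p n (fun s => ~~ dies true y s && (a.+1 <= ups true s)%N) <=
    sk01 L w + eta + (20 * L + 4) * mu.
Proof.
move=> abn bay wL aw ye.
have := bern_survives_up_le p01 bay.
have := binE_sk01_approx abn wL aw; rewrite abn ler_norml => /andP[_ h].
have : p * y%:R <= y%:R * mu by rewrite mulrC ler_wpM2l//; case/andP: pmu.
lra.
Qed.

End SkellamApprox.

(** * Turns of the telegraph process on a grid *)

Section Bits.
Context (R : realType) (d : measure_display) (W : measurableType d).
Variables (P : probability W R) (lam c : R) (N : R -> W -> nat) (V0 : W -> R).
Hypothesis lam_gt0 : 0 < lam.
Hypothesis driver : telegraph_driver P lam c N V0.

Let poissonN : poisson_process P lam N. Proof. by case: driver. Qed.

Lemma measurable_increment d' (T : measurableType d') (X Y : T -> nat)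
    (B : set nat) : measurable_fun setT X -> measurable_fun setT Y ->
  measurable [set w | B (Y w - X w)%N].
Proof.
move=> mX mY.
rewrite (_ : [set w | _] = \bigcup_k \bigcup_(l in [set l | B (l - k)%N])
    (X @^-1` [set k] `&` Y @^-1` [set l])); last first.
  apply/seteqP; split => [w Bw|w [k _ [l Bl [/= -> ->]]]]//.
  by exists (X w) => //; exists (Y w).
apply: bigcup_measurable => k _; apply: bigcup_measurable => l _.
by apply: measurableI; rewrite -[X in measurable X]setTI; [exact: mX|exact: mY].
Qed.

Lemma increment_law (s u s' u' : R) (B : set nat) :
  0 <= s -> s < u -> 0 <= s' -> s' < u' -> u - s = u' - s' ->
  P [set w | B (N u w - N s w)%N] = P [set w | B (N u' w - N s' w)%N].
Proof.
move=> s0 su s'0 s'u' us.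
have key (x y : R) : 0 <= x -> x < y -> P [set w | B (N y w - N x w)%N] =
    (\sum_(k <oo | k \in B) (poisson_pmf (lam * (y - x)) k)%:E)%E.
  move=> x0 xy.
  have mN z : x <= z -> measurable_fun setT (N z).
    by move=> xz; apply: (poisson_measurable poissonN); exact: le_trans xz.
  rewrite (_ : [set w | _] = \bigcup_(k in B) [set w | (N y w - N x w)%N = k]);
    last first.
    apply/seteqP; split => [w Bw|w [k Bk /= e]]; last by rewrite e.
    by exists (N y w - N x w)%N.
  rewrite measure_bigcup.
  - by apply: eq_eseriesr => k _; exact: (poisson_increment poissonN).
  - move=> k _; apply: (measurable_increment [set k]).
      exact: mN.
    exact: mN (ltW xy).
  - by move=> k l _ _ [w [/= e1 e2]]; rewrite -e1 -e2.
by rewrite !key// us.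
Qed.

Variable h : R.
Hypothesis h_gt0 : 0 < h.

(** Only the parity matters: after an even number of jumps in a cell the velocity at the next grid
    point is unchanged. *)
Definition turn (i : nat) (w : W) : bool :=
  odd (N (h * i.+1%:R) w - N (h * i%:R) w).

Definition turns (m l : nat) (w : W) : seq bool :=
  [seq turn i w | i <- iota m l].

Definition turn_prob : R := fine (P [set w | turn 0 w]).

Lemma measurable_turn i b : measurable [set w | turn i w = b].
Proof.
apply: (measurable_increment [set k | odd k = b]);
  by apply: (poisson_measurable poissonN); rewrite mulr_ge0// ltW.
Qed.

Lemma turn_law i b :
  P [set w | turn i w = b] = (if b then turn_prob else 1 - turn_prob)%:E.
Proof.
have e : P [set w | turn i w = b] = P [set w | turn 0 w = b].
  apply: (@increment_law _ _ _ _ [set k | odd k = b]).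
  - by rewrite mulr_ge0// ltW.
  - by rewrite ltr_pM2l// ltr_nat.
  - by rewrite mulr0.
  - by rewrite mulr0 mulr1.
  - by rewrite -natr1; ring.
have pE : P [set w | turn 0 w] = turn_prob%:E.
  rewrite fineK//; apply: fin_num_measure; exact: measurable_turn 0 true.
rewrite e; case: b {e}; first exact: pE.
rewrite (_ : [set w | _] = ~` [set w | turn 0 w]); last first.
  by apply/seteqP; split => w /=; case: (turn 0 w).
rewrite [LHS]probability_setC; last exact: (measurable_turn 0 true).
by rewrite [in LHS]pE -EFinB.
Qed.

Lemma turn_prob01 : 0 <= turn_prob <= 1.
Proof.
have := turn_law 0 true; rewrite /= => pE.
rewrite -!lee_fin -[X in (_ <= X <= _)%E]pE measure_ge0 probability_le1//.
exact: measurable_turn.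
Qed.

(** Exactly one jump forces a turn and has probability lam h [expR] (- lam h) >= lam h (1 - lam h);
    a turn forces at least one jump, of probability 1 - [expR] (- lam h) <= lam h. *)
Lemma turn_prob_bounds : lam * h - (lam * h) ^+ 2 <= turn_prob <= lam * h.
Proof.
have lh : 0 < lam * h by rewrite mulr_gt0.
have ms k : measurable [set w | (N (h * 1%:R) w - N (h * 0%:R) w)%N = k].
  by apply: (measurable_increment [set k]);
    apply: (poisson_measurable poissonN); rewrite mulr_ge0// ltW.
have incr k : P [set w | (N (h * 1%:R) w - N (h * 0%:R) w)%N = k] =
    (poisson_pmf (lam * h) k)%:E.
  rewrite (poisson_increment poissonN) ?mulr0 ?mulr1//.
  by rewrite subr0.
have mt := measurable_turn 0 true.
have pE : P [set w | turn 0 w = true] = turn_prob%:E by rewrite turn_law.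
apply/andP; split.
- have : (P [set w | (N (h * 1%:R) w - N (h * 0%:R) w)%N = 1%N] <=
      P [set w | turn 0 w = true])%E.
    by apply: le_measure; rewrite ?inE// => w /= e; rewrite /turn e.
  rewrite incr pE lee_fin /poisson_pmf lh expr1 factS fact0 muln1 invr1 mulr1.
  apply: le_trans; rewrite (_ : _ - _ = lam * h * (1 - lam * h)); last by ring.
  by rewrite ler_wpM2l ?(ltW lh)// expR_ge1Dx.
- have : (P [set w | turn 0 w = true] <=
      P (~` [set w | (N (h * 1%:R) w - N (h * 0%:R) w)%N = 0%N]))%E.
    apply: le_measure; rewrite ?inE//; first exact: measurableC.
    by move=> w /= + e; rewrite /turn e.
  rewrite pE probability_setC// incr -EFinB lee_fin /poisson_pmf lh.
  rewrite expr0 fact0 invr1 !mul1r => /le_trans; apply.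
  by have := expR_ge1Dx (- (lam * h)); lra.
Qed.

Lemma bits_law_exact v (bs : seq bool) : P (V0 @^-1` [set v]) = (2^-1)%:E ->
  P [set w | V0 w = v /\ turns 0 (size bs) w = bs] =
  (2^-1 * \prod_(b <- bs) (if b then turn_prob else 1 - turn_prob))%:E.
Proof.
move=> Pv.
pose B i := [set k | odd k = nth false bs i].
pose E := \bigcap_(i in [set i | (i < size bs)%N])
  [set w | B i (N (h * i.+1%:R) w - N (h * i%:R) w)%N].
have turnsE w : (turns 0 (size bs) w = bs) <-> E w.
  split => [e i /= ib|Ew].
    by rewrite /B /= -{1}e (nth_map 0%N) ?size_iota// nth_iota// add0n.
  apply: (@eq_from_nth _ false); first by rewrite size_map size_iota.
  move=> i; rewrite size_map size_iota => ib.
  by rewrite (nth_map 0%N) ?size_iota// nth_iota// add0n; exact: Ew.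
rewrite (_ : [set w | _] = V0 @^-1` [set v] `&` E); last first.
  by apply/seteqP; split => w [? /turnsE].
have [_ _ indep] := driver; rewrite indep; last 2 first.
- by exists [set v] => //; rewrite setTI.
(* Independence is assumed for the sigma-algebra generated by N, so E must be measurable for that
   one and not only for W. *)
- pose G := \bigcup_(s in `[0, +oo[) preimage_set_system setT (N s) measurable.
  have mN (s : R) : 0 <= s ->
      measurable_fun [set: g_sigma_algebraType G] (N s : g_sigma_algebraType G -> nat).
    move=> s0 _ Y mY; apply: sub_sigma_algebra; exists s.
      by rewrite /= in_itv/= s0.
    by exists Y.
  have : measurable (E : set (g_sigma_algebraType G)).
    apply: fin_bigcap_measurable => [|i _]; first exact: finite_II.
    apply: (@measurable_increment _ (g_sigma_algebraType G) _ _ (B i));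
      by apply: mN; rewrite mulr_ge0// ltW.
  by [].
rewrite Pv EFinM; congr (_ * _)%E.
rewrite (poisson_independent poissonN (size bs) (s := fun i => h * i%:R)).
- rewrite (big_nth false) big_mkord.
  rewrite -prodEFin; apply: eq_bigr => i _.
  exact: turn_law.
- by rewrite mulr0.
- by move=> i; rewrite ler_pM2l// ler_nat.
Qed.

Lemma turns_rcons bs b w :
  turns 0 (size (rcons bs b)) w = rcons bs b <->
  turns 0 (size bs) w = bs /\ turn (size bs) w = b.
Proof.
rewrite /turns size_rcons -addn1 iotaD map_cat /= cats1 add0n.
split=> [/eqP|[-> ->]//].
by rewrite eqseq_rcons => /andP[/eqP -> /eqP ->].
Qed.

Lemma measurable_turns_exact v bs :
  measurable [set w | V0 w = v /\ turns 0 (size bs) w = bs].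
Proof.
have [_ [mV _ _] _] := driver.
elim/last_ind: bs => [|bs b IH].
  rewrite (_ : [set w | _] = V0 @^-1` [set v]).
    by rewrite -[X in measurable X]setTI; exact: mV.
  by apply/seteqP; split => [w []|w ?].
rewrite (_ : [set w | _] = [set w | V0 w = v /\ turns 0 (size bs) w = bs] `&`
    [set w | turn (size bs) w = b]); last first.
  by apply/seteqP; split => [w [? /turns_rcons[]]|w [[? ?] ?]]//;
    split => //; apply/turns_rcons.
by apply: measurableI => //; exact: measurable_turn.
Qed.

(** [bern] splits on the first bit, so the induction carries a prefix bs of turns already fixed and
    ends in [bits_law_exact]. *)
Lemma bits_law_from v l bs (f : seq bool -> bool) :
  P (V0 @^-1` [set v]) = (2^-1)%:E ->
  let E := [set w | [/\ V0 w = v, turns 0 (size bs) w = bs &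
                       f (turns (size bs) l w)]] in
  measurable E /\
  P E = (2^-1 * \prod_(b <- bs) (if b then turn_prob else 1 - turn_prob) *
         bern turn_prob l f)%:E.
Proof.
move=> Pv; elim: l bs f => [|l IH] bs f /=.
  have [fn|fn] := boolP (f [::]).
    rewrite (_ : [set w | _] = [set w | V0 w = v /\ turns 0 (size bs) w = bs]).
      by rewrite bits_law_exact// mulr1; split => //; exact: measurable_turns_exact.
    by apply/seteqP; split => [w []|w []].
  rewrite (_ : [set w | _] = set0); first by rewrite measure0 mulr0.
  by apply/seteqP; split => [w []|w []].
have [m0 P0] := IH (rcons bs false) (fun s => f (false :: s)).
have [m1 P1] := IH (rcons bs true) (fun s => f (true :: s)).
pose E b := [set w | [/\ V0 w = v,
  turns 0 (size (rcons bs b)) w = rcons bs b &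
  f (b :: turns (size (rcons bs b)) l w)]].
rewrite (_ : [set w | _] = E false `|` E true); last first.
  have tS w : turns (size bs) l.+1 w = turn (size bs) w :: turns (size bs).+1 l w.
    by [].
  apply/seteqP; split => w /=; rewrite tS.
    move=> [? tw]; case tb : (turn (size bs) w) => fw; [right|left];
      by split; [by []|apply/turns_rcons|rewrite size_rcons].
  by move=> [] [? /turns_rcons[? tb]]; rewrite size_rcons => fw; split => //;
    rewrite tb.
split; first exact: measurableU.
rewrite measureU//; last first.
  apply/seteqP; split => // w [[_ /turns_rcons[_ e] _] [_ /turns_rcons[_]]].
  by rewrite e.
rewrite -[X in (X + _)%E]/(P [set w | _]) P0 -[X in (_ + X)%E]/(P [set w | _]) P1.
by rewrite -EFinD !big_rcons /=; congr EFin; ring.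
Qed.

Lemma bits_law v l (f : seq bool -> bool) :
  P (V0 @^-1` [set v]) = (2^-1)%:E ->
  measurable [set w | V0 w = v /\ f (turns 0 l w)] /\
  P [set w | V0 w = v /\ f (turns 0 l w)] = (2^-1 * bern turn_prob l f)%:E.
Proof.
move=> Pv; have := bits_law_from l [::] f Pv; rewrite /= big_nil mulr1.
rewrite (_ : [set w | [/\ _, _ & _]] = [set w | V0 w = v /\ f (turns 0 l w)])//.
by apply/seteqP; split => w; case.
Qed.

End Bits.

(** * Telegraph paths and walks *)

Section Path.
Variables (R : realType) (n : R -> nat).
Hypothesis n_homo : forall s u : R, 0 <= s -> s <= u -> (n s <= n u)%N.
Local Notation mu := (@lebesgue_measure R).

Definition signed_path (v s : R) : R :=
  \int[mu]_(u in `[0, s]) (v * (-1) ^+ n u).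

Variable v : R.
Let vel (u : R) : R := v * (-1) ^+ n u.

Let norm_vel u : `|vel u| = `|v|.
Proof. by rewrite normrM normrX normrN1 expr1n mulr1. Qed.

(** Monotone functions are measurable; clipping time at 0 makes the counting path monotone on the
    whole line, its values at negative times being unconstrained. *)
Lemma measurable_vel (s : R) : measurable_fun `[0, s] vel.
Proof.
pose m (u : R) : R := (n (Num.max 0 u))%:R.
have mm : measurable_fun setT m.
  apply: nondecreasing_measurable => // x y xy; rewrite /m ler_nat n_homo//.
    by rewrite le_max lexx.
  by rewrite ge_max !le_max lexx xy orbT.
suff mvel : measurable_fun setT (fun u : R => v * (-1) ^+ n (Num.max 0 u)).
  apply: eq_measurable_fun (measurable_funTS mvel) => u.
  by rewrite inE/= in_itv/= => /andP[u0 _]; rewrite /vel max_r.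
move=> _ Y mY; rewrite setTI.
rewrite (_ : _ @^-1` Y = \bigcup_(k in [set k : nat | Y (v * (-1) ^+ k)])
    (setT `&` m @^-1` [set k%:R])); last first.
  apply/seteqP; split => [u /= Yu|u [k /= Yk [_ /eqP]]].
    by exists (n (Num.max 0 u)).
  by rewrite /m eqr_nat => /eqP ->.
by apply: bigcup_measurable => k _; exact: mm.
Qed.

Lemma integrable_vel (s : R) : mu.-integrable `[0, s] (EFin \o vel).
Proof.
apply: measurable_bounded_integrable => //.
- by rewrite /= lebesgue_measure_itv/=; case: ifP; rewrite ltry.
- exact: measurable_vel.
- exists `|v|; split; first exact: num_real.
  by move=> M vM u _ /=; rewrite norm_vel ltW.
Qed.

Let signed_path_diff (a b : R) : 0 <= a -> a <= b ->
  signed_path v b - signed_path v a = \int[mu]_(u in `]a, b]) vel u.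
Proof.
move=> a0 ab; apply: (@Rintegral_itvB R vel (BLeft 0) (BRight b) a);
  [exact: integrable_vel|by rewrite bnd_simp|by rewrite bnd_simp].
Qed.

Let integrable_vel_sub (a b : R) : 0 <= a ->
  mu.-integrable `]a, b] (EFin \o vel).
Proof.
move=> a0; apply: integrableS (integrable_vel b) => //.
by apply: subset_itvr; rewrite bnd_simp.
Qed.

Let length_itv (a b : R) : a <= b -> fine (mu `]a, b]) = b - a.
Proof.
move=> ab; rewrite /= lebesgue_measure_itv/= lte_fin.
by case: ltP => // ba; rewrite (le_anti (_ : a <= b <= a)) ?subrr ?ab.
Qed.

Lemma signed_path0 : signed_path v 0 = 0.
Proof. by rewrite /signed_path set_itv1 Rintegral_set1. Qed.

Lemma signed_path_lipschitz (a b : R) : 0 <= a -> a <= b ->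
  `|signed_path v b - signed_path v a| <= `|v| * (b - a).
Proof.
move=> a0 ab; rewrite signed_path_diff//.
apply: le_trans (le_normr_Rintegral _ _) _ => //; first exact: integrable_vel_sub.
under eq_Rintegral do rewrite norm_vel.
by rewrite Rintegral_cst// length_itv.
Qed.

Lemma signed_path_const (a b : R) : 0 <= a -> a <= b -> n a = n b ->
  signed_path v b - signed_path v a = vel a * (b - a).
Proof.
move=> a0 ab nab; rewrite signed_path_diff//.
rewrite (@eq_Rintegral _ _ _ _ _ (fun=> vel a)).
  by rewrite Rintegral_cst// length_itv.
move=> u; rewrite inE/= in_itv/= => /andP[au ub]; rewrite /vel.
congr (_ * _ ^+ _); apply/eqP; rewrite eqn_leq {1}nab.
by rewrite !n_homo// ?(le_trans a0)// ltW.
Qed.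

(** By the Lipschitz bound, fine grids see the infimum of the path. Countably many conditions at
    fixed times make the event measurable. *)
Lemma inf_signed_path_geP (t a : R) : 0 < t ->
  (a <= inf [set signed_path v s | s in `[0, t]]) <->
  (forall k i, (i <= k.+1)%N -> a <= signed_path v (t / k.+1%:R * i%:R)).
Proof.
move=> t0; split=> [ainf k i ik|H].
  apply: le_trans ainf _; apply: inf_lbound.
    exists (- (`|v| * t)) => _ [u + <-]; rewrite /= in_itv/= => /andP[u0 ut].
    have := signed_path_lipschitz (lexx 0) u0; rewrite signed_path0 !subr0.
    rewrite ler_norml => /andP[+ _]; apply: le_trans.
    by rewrite lerN2 ler_wpM2l.
  exists (t / k.+1%:R * i%:R) => //=; rewrite in_itv/=; apply/andP; split.
    by rewrite mulr_ge0// divr_ge0// ltW.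
  by rewrite mulrAC ler_pdivrMr// ler_pM2l// ler_nat.
apply: lb_le_inf.
  by exists (signed_path v 0), 0 => //=; rewrite in_itv/= lexx ltW.
move=> _ [s + <-]; rewrite /= in_itv/= => /andP[s0 st].
apply/ler_addgt0Pr => e e0.
(* Enough cells for the path to move by at most e within one of them. *)
pose k := Num.truncn (`|v| * t / e); have := truncn_itv (_ : 0 <= `|v| * t / e).
rewrite -/k divr_ge0 ?mulr_ge0 ?(ltW t0) ?(ltW e0)// => /(_ isT)/andP[_ ke].
have k0 : 0 < k.+1%:R :> R by [].
have h0 : 0 < t / k.+1%:R by rewrite divr_gt0.
have sh0 : 0 <= s / (t / k.+1%:R) by rewrite divr_ge0// ltW.
have := truncn_itv sh0; set i := Num.truncn _ => /andP[].
rewrite ler_pdivlMr// ltr_pdivrMr// -(natr1 i) mulrDl mul1r => is1 is2.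
have ik : (i <= k.+1)%N.
  rewrite -(ler_nat R) -(ler_pM2r h0); apply: le_trans is1 _.
  by rewrite mulrCA mulfV ?mulr1// gt_eqF.
have i0 : 0 <= t / k.+1%:R * i%:R by rewrite mulr_ge0// ltW.
rewrite mulrC in is1.
have := signed_path_lipschitz i0 is1; rewrite ler_norml => /andP[+ _].
have := H k i ik; rewrite (mulrC i%:R) in is2 => Hki.
have : `|v| * (s - t / k.+1%:R * i%:R) <= `|v| * (t / k.+1%:R).
  by rewrite ler_wpM2l// lerBlDl ltW.
have : `|v| * (t / k.+1%:R) <= e.
  by rewrite mulrA ler_pdivrMr// [leRHS]mulrC -ler_pdivrMr// ltW.
move: Hki; move: (`|v| * (t / _)) (`|v| * (s - _)) (signed_path v (_ * _)).
by move=> A B C; lra.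
Qed.

Variable h : R.
Hypothesis h_gt0 : 0 < h.

Definition grid_path k : R := \sum_(i < k) vel (h * i%:R) * h.

Lemma grid_pathS k : grid_path k.+1 = grid_path k + vel (h * k%:R) * h.
Proof. by rewrite /grid_path big_ord_recr. Qed.

Let hk0 k : 0 <= h * k%:R. Proof. by rewrite mulr_ge0// ltW. Qed.

(** On a cell without a jump both paths have the same increment, on any other the increments differ
    by at most 2 |v| h; the number of cells with a jump is at most the number of jumps. *)
Lemma grid_path_error k :
  `|signed_path v (h * k%:R) - grid_path k| <=
    2 * `|v| * h * (n (h * k%:R))%:R.
Proof.
elim: k => [|k IH].
  by rewrite mulr0 signed_path0 /grid_path big_ord0 subrr normr0 !mulr_ge0// ltW.
rewrite grid_pathS.
have hS : h * k.+1%:R = h * k%:R + h by rewrite -natr1; ring.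
have hkk : h * k%:R <= h * k.+1%:R by rewrite hS lerDl ltW.
rewrite (_ : _ - _ = (signed_path v (h * k%:R) - grid_path k) +
  (signed_path v (h * k.+1%:R) - signed_path v (h * k%:R) - vel (h * k%:R) * h));
  last by ring.
apply: le_trans (ler_normD _ _) _.
have hL := signed_path_lipschitz (hk0 k) hkk.
have hC := signed_path_const (hk0 k) hkk.
have := n_homo (hk0 k) hkk; rewrite leq_eqVlt => /predU1P[e|lt].
  rewrite hC// {1}hS [X in `|_ * X - _|](_ : _ = h); last by ring.
  by rewrite subrr normr0 addr0 -e.
have : (n (h * k%:R))%:R + 1 <= (n (h * k.+1%:R))%:R :> R by rewrite natr1 ler_nat.
move=> /(ler_wpM2l (_ : 0 <= 2 * `|v| * h)).
rewrite mulrDr mulr1 => /(_ ltac:(by rewrite !mulr_ge0// ltW)); apply: le_trans.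
apply: lerD => //; apply: le_trans (ler_normB _ _) _.
rewrite (normrM (vel _)) norm_vel (gtr0_norm h_gt0).
have -> : 2 * `|v| * h = `|v| * h + `|v| * h by ring.
rewrite lerD2r; apply: le_trans hL _.
by rewrite hS [X in _ * X](_ : _ = h)//; ring.
Qed.

Variables (c : R) (up0 : bool).
Hypothesis vE : v = if up0 then c else - c.

Let dir k := up0 (+) odd (n (h * k%:R)).

Let path_turn i := odd (n (h * i.+1%:R) - n (h * i%:R)).

Let path_turns m l := [seq path_turn i | i <- iota m l].

Let dirS k : dir k.+1 = dir k (+) path_turn k.
Proof.
rewrite /dir /path_turn oddB; last first.
  by rewrite n_homo// ler_wpM2l ?ler_nat// ltW.
by case: up0; case: odd; case: odd.
Qed.

Let vel_dir k : vel (h * k%:R) = if dir k then c else - c.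
Proof.
rewrite /vel vE /dir -signr_odd.
by case: up0; case: odd; rewrite /= ?expr0 ?expr1; ring.
Qed.

Let grid_path_shift m k : grid_path (m + k.+1) - grid_path m =
  (grid_path (m.+1 + k) - grid_path m.+1) + (if dir m then c * h else - (c * h)).
Proof.
rewrite (_ : (if _ then _ else _) = vel (h * m%:R) * h).
  by rewrite addSnnS (grid_pathS m); ring.
by rewrite vel_dir; case: (dir m) => //; rewrite mulNr.
Qed.

Let grid_path_ups m l :
  grid_path (m + l) - grid_path m =
  c * h * (2 * (ups (dir m) (path_turns m l))%:R - l%:R).
Proof.
elim: l m => [|l IH] m; first by rewrite addn0 subrr mulr0 subr0 mulr0.
rewrite grid_path_shift IH dirS /= natrD -natr1.
by case: (dir m) => /=; rewrite ?mulr0n; ring.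
Qed.

Let grid_path_dies m l y : 0 < c ->
  reflect (forall k, (k <= l)%N ->
             0 <= y%:R * (c * h) + (grid_path (m + k) - grid_path m))
          (~~ dies (dir m) y (path_turns m l)).
Proof.
move=> c0; have ch0 : 0 < c * h by rewrite mulr_gt0.
have y0 k : 0 <= k%:R * (c * h) by rewrite mulr_ge0// ltW.
elim: l m y => [|l IH] m y.
  apply: (iffP idP) => // _ k; rewrite leqn0 => /eqP ->.
  by rewrite addn0 subrr addr0.
have gS := grid_path_shift m.
have {}IH := IH m.+1; move: IH gS; rewrite dirS /=; case: (dir m) => /= IH gS.
  apply: (iffP (IH y.+1)) => H k kl.
    case: k kl => [|k] kl; first by rewrite addn0 subrr addr0.
    by rewrite gS; have := H k kl; rewrite -natr1; lra.
  by have := H k.+1 kl; rewrite gS -natr1; lra.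
case: y => [|y].
  apply: (iffP idP) => // /(_ 1%N isT); rewrite gS addn0 subrr.
  by lra.
apply: (iffP (IH y)) => H k kl.
  case: k kl => [|k] kl; first by rewrite addn0 subrr addr0.
  by rewrite gS; have := H k kl; rewrite -natr1; lra.
by have := H k.+1 kl; rewrite gS -natr1; lra.
Qed.

Hypothesis c_gt0 : 0 < c.
Hypothesis n0 : n 0 = 0%N.

Variable m : nat.

Let t : R := h * m%:R.
Let err : R := 2 * c * h * (n t)%:R.

Let norm_v : `|v| = c.
Proof. by rewrite vE; case: up0; rewrite ?normrN gtr0_norm. Qed.

Let err_le k : (k <= m)%N -> `|signed_path v (h * k%:R) - grid_path k| <= err.
Proof.
move=> km; apply: le_trans (grid_path_error k) _.
rewrite norm_v ler_wpM2l ?mulr_ge0 ?(ltW c_gt0) ?(ltW h_gt0)// ler_nat.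
by rewrite n_homo// ler_pM2l// ler_nat.
Qed.

Let signed_path_ge (s : R) : 0 <= s <= t -> - (c * t) <= signed_path v s.
Proof.
move=> /andP[s0 st].
have := signed_path_lipschitz (lexx 0) s0; rewrite signed_path0 !subr0 norm_v.
rewrite ler_norml => /andP[+ _]; apply: le_trans.
by rewrite lerN2 ler_pM2l.
Qed.

Let path_min := inf [set signed_path v s | s in `[0, t]].

Let path_min_le (s : R) : 0 <= s <= t -> path_min <= signed_path v s.
Proof.
move=> st; apply: inf_lbound; last by exists s => //=; rewrite in_itv.
exists (- (c * t)) => _ [u + <-]; rewrite /= in_itv/= => ut.
exact: signed_path_ge.
Qed.

Let dir0 : dir 0 = up0.
Proof. by rewrite /dir mulr0 n0 addbF. Qed.

(** At grid points the two paths differ by at most [err], so a path above - e gives a grid path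
    above - (e + [err]), hence at most y levels down. The strict inequality on a is what yields a +
    1 steps up. *)
Lemma walk_of_path a y (e x : R) :
  e + err <= y%:R * (c * h) -> c * h * (2 * a%:R - m%:R) < x - err ->
  - e <= path_min -> x <= signed_path v t ->
  ~~ dies up0 y (path_turns 0 m) && (a.+1 <= ups up0 (path_turns 0 m))%N.
Proof.
move=> ey ax emin xt; apply/andP; split.
  rewrite -{1}dir0; apply/grid_path_dies => // k km.
  rewrite add0n [grid_path 0]/grid_path big_ord0 subr0.
  have := err_le km; rewrite ler_norml => /andP[_].
  have : path_min <= signed_path v (h * k%:R).
    by apply: path_min_le; rewrite hk0 /= ler_pM2l// ler_nat.
  by lra.
have := grid_path_ups 0 m; rewrite dir0 add0n [grid_path 0]/grid_path big_ord0 subr0.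
have := err_le (leqnn m); rewrite -/t ler_norml => /andP[_ h1] h2.
have : c * h * (2 * a%:R - m%:R) < c * h * (2 * (ups up0 (path_turns 0 m))%:R - m%:R).
  by rewrite -h2; lra.
rewrite ltr_pM2l ?mulr_gt0// => ?.
by rewrite -(ltr_nat R); lra.
Qed.

(** Between two grid points the path may go down by a further c h, whence this term in the bound on
    the minimum. *)
Lemma path_of_walk a y (e x : R) :
  y%:R * (c * h) <= e -> x <= c * h * (2 * a%:R - m%:R) ->
  ~~ dies up0 y (path_turns 0 m) && (a <= ups up0 (path_turns 0 m))%N ->
  - (e + err + c * h) <= path_min /\ x - err <= signed_path v t.
Proof.
move=> ye xa /andP[]; rewrite -{1}dir0 => /grid_path_dies dm am; split; last first.
  have := grid_path_ups 0 m.
  rewrite dir0 add0n [grid_path 0]/grid_path big_ord0 subr0.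
  have := err_le (leqnn m); rewrite -/t ler_norml => /andP[h1 _] h2.
  have : c * h * (2 * a%:R - m%:R) <= c * h * (2 * (ups up0 (path_turns 0 m))%:R - m%:R).
    by rewrite ler_pM2l ?mulr_gt0// lerD2r ler_pM2l// ler_nat.
  by rewrite -h2; lra.
apply: lb_le_inf.
  by exists (signed_path v 0), 0 => //=; rewrite in_itv/= lexx mulr_ge0// ltW.
move=> _ [s + <-]; rewrite /= in_itv/= => /andP[s0 st].
have [k km [ks sk]] : exists2 k, (k <= m)%N & h * k%:R <= s /\ s <= h * k%:R + h.
  have sh0 : 0 <= s / h by rewrite divr_ge0// ltW.
  have := truncn_itv sh0; set k := Num.truncn _ => /andP[k1 k2].
  exists k.
    rewrite -(ler_nat R); apply: le_trans k1 _.
    by rewrite ler_pdivrMr// mulrC.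
  move: k1 k2; rewrite ler_pdivlMr// ltr_pdivrMr// -natr1 mulrDl mul1r.
  by rewrite mulrC => -> /ltW; rewrite (mulrC h).
have := dm c_gt0 k km; rewrite add0n [grid_path 0]/grid_path big_ord0 subr0.
have := err_le km; have := signed_path_lipschitz (hk0 k) ks; rewrite norm_v.
have : c * (s - h * k%:R) <= c * h by rewrite ler_pM2l//; lra.
by rewrite !ler_norml => ? /andP[? _] /andP[? _]; lra.
Qed.

End Path.

(** * Limit of the survival probabilities *)

Section Antiderivative.
Variables (R : realType).
Local Notation mu := (@lebesgue_measure R).

Lemma exists_antiderivative (f : R -> R) (a b : R) : continuous f ->
  exists J : R -> R, forall z, a <= z <= b -> is_derive z 1 J (f z).
Proof.
(* Starting the integral at a - 1 makes the end points of [a, b] interior, so that the derivative is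
   two-sided there as well. *)
move=> cf; exists (fun x => \int[mu]_(u in `[a - 1, x]) f u) => z /andP[az zb].
have zb' : z < b + 1 by rewrite (le_lt_trans zb)// ltrDl.
have fi : mu.-integrable `[a - 1, b + 1] (EFin \o f).
  apply: continuous_compact_integrable; first exact: segment_compact.
  exact: continuous_subspaceT.
have az' : a - 1 < z by rewrite (lt_le_trans _ az)// gtrDl ltrN10.
have [dJ eJ] := continuous_FTC1_closed zb' fi az' (cf z).
by apply: DeriveDef; [exact: dJ|rewrite -derive1E].
Qed.

End Antiderivative.

(* lam times the time spent going up before t by a path ending at x, and lam
   times the time needed to climb e: the means of the limiting Poisson variables. *)
Definition ups_scale (R : realType) (lam c t x : R) : R := lam * (t + x / c) / 2.
Definition height_scale (R : realType) (lam c e : R) : R := lam * e / c.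

Lemma ups_scaleE (R : realType) (lam c t x : R) : 0 < c ->
  ups_scale lam c t x = lam / c * (c * t + x) / 2.
Proof. by move=> c0; rewrite /ups_scale; field; rewrite gt_eqF. Qed.

Lemma height_scaleE (R : realType) (lam c e : R) :
  height_scale lam c e = lam / c * e.
Proof. by rewrite /height_scale mulrAC. Qed.

Section Tails.
Context (R : realType) (d : measure_display) (W : measurableType d).
Variables (P : probability W R) (lam c t : R) (N : R -> W -> nat) (V0 : W -> R).
Hypotheses (lam_gt0 : 0 < lam) (c_gt0 : 0 < c) (t_gt0 : 0 < t).
Hypothesis driver : telegraph_driver P lam c N V0.

Let poissonN : poisson_process P lam N. Proof. by case: driver. Qed.

Let mV0 : measurable_fun setT V0. Proof. by case: driver => _ []. Qed.

Let N_homo w (s u : R) : 0 <= s -> s <= u -> (N s w <= N u w)%N.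
Proof. exact: (poisson_homo poissonN). Qed.

Let mN (s : R) : 0 <= s -> measurable_fun setT (N s).
Proof. exact: (poisson_measurable poissonN). Qed.

(** A pointwise limit of grid paths, each depending on [V0] and finitely many [N s]; for fixed w the
    error bound is a constant divided by k + 1. *)
Lemma measurable_telegraph (s : R) : 0 <= s ->
  measurable_fun setT (telegraph N V0 s).
Proof.
rewrite le_eqVlt => /predU1P[<-|s0].
  rewrite (_ : telegraph N V0 0 = cst 0) //.
  by apply/funext => w; exact: (signed_path0 (N^~ w) (V0 w)).
pose h (k : nat) := s / k.+1%:R.
have h0 k : 0 < h k by rewrite divr_gt0.
apply: (@measurable_fun_cvg _ _ _ _
  (fun k w => grid_path (N^~ w) (V0 w) (h k) k.+1)) => [k|w _].
  apply: measurable_sum => i.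
  apply: measurable_funM => //; apply: measurable_funM => //.
  apply: (@measurableT_comp _ _ _ _ _ _ (fun k : nat => (-1) ^+ k : R)) => //.
  by apply: mN; rewrite mulr_ge0// ltW.
apply/cvgrPdist_le => e e0; near=> k.
have := grid_path_error (@N_homo w) (V0 w) (h0 k) k.+1.
have -> : h k * k.+1%:R = s by rewrite /h divfK.
move=> /le_trans; apply.
rewrite /h (_ : _ * _ = (2 * `|V0 w| * s * (N s w)%:R) / k.+1%:R); last by ring.
rewrite ler_pdivrMr// [leRHS]mulrC -ler_pdivrMr//.
rewrite -(natr1 k) ler_wpDr//; near: k; exact: nbhs_infty_ger.
Unshelve. all: by end_near. Qed.

Lemma measurable_min_ge (a : R) : measurable (min_ge (telegraph N V0) t a).
Proof.
rewrite (_ : min_ge _ _ _ = \bigcap_k \bigcap_(i in [set i | (i <= k.+1)%N])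
    [set w | a <= telegraph N V0 (t / k.+1%:R * i%:R) w]); last first.
  apply/seteqP; split => w.
    by move/(inf_signed_path_geP (@N_homo w) (V0 w) a t_gt0) => H k _ i /= ik; exact: H.
  move=> H; apply/(inf_signed_path_geP (@N_homo w) (V0 w) a t_gt0) => k i ik.
  exact: H.
apply: bigcapT_measurable => k; apply: bigcap_measurable => [|i _].
  by exists 0%N.
have s0 : 0 <= t / k.+1%:R * i%:R by rewrite mulr_ge0// divr_ge0// ltW.
rewrite (_ : [set w | _] = telegraph N V0 (t / k.+1%:R * i%:R) @^-1` `[a, +oo[).
  by rewrite -[X in measurable X]setTI; exact: measurable_telegraph.
by apply/seteqP; split => w; rewrite /= in_itv/= andbT.
Qed.

Definition tail_event (v e x : R) : set W :=
  [set w | V0 w = v] `&` min_ge (telegraph N V0) t (- e) `&`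
  [set w | x <= telegraph N V0 t w].

Lemma measurable_tail_event v e x : measurable (tail_event v e x).
Proof.
apply: measurableI; first apply: measurableI.
- rewrite (_ : [set w | _] = V0 @^-1` [set v])//.
  by rewrite -[X in measurable X]setTI; exact: mV0.
- exact: measurable_min_ge.
- rewrite (_ : [set w | _] = telegraph N V0 t @^-1` `[x, +oo[).
    rewrite -[X in measurable X]setTI; apply: measurable_telegraph => //.
    exact: ltW.
  by apply/seteqP; split => w; rewrite /= in_itv/= andbT.
Qed.

(** Off this event the grid error is bounded uniformly in w. *)
Let many K := [set w | (K < N t w)%N].

Let measurable_many K : measurable (many K).
Proof.
rewrite -[X in measurable X]setTI.
by have := @mN t (ltW t_gt0) measurableT [set k | (K < k)%N] I.
Qed.

Let many_small (e : R) : 0 < e -> exists K, (P (many K) <= e%:E)%E.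
Proof.
move=> e0.
have : P \o many @ \oo --> P (\bigcap_K many K).
  apply: nonincreasing_cvg_mu.
  - by rewrite ltey_eq fin_num_measure.
  - by [].
  - exact: bigcapT_measurable.
  - move=> m k mk; apply/subsetPset => w /=; exact: leq_ltn_trans.
rewrite (_ : \bigcap_K many K = set0) ?measure0; last first.
  by apply/seteqP; split => // w /(_ (N t w) I); rewrite /many /= ltnn.
move=> /fine_cvgP[_ /cvgrPdist_le /(_ e e0)[K _ H]].
exists K; have := H K (leqnn K); rewrite sub0r normrN => h.
rewrite -[P _]fineK ?fin_num_measure// lee_fin.
by apply: le_trans h; exact: ler_norm.
Qed.

Variable up0 : bool.
Let v0 := if up0 then c else - c.

Let Pv0 : P (V0 @^-1` [set v0]) = (2^-1)%:E.
Proof. by case: driver => _ [_ ? ?] _; rewrite /v0; case: up0. Qed.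

Definition survive (y a : nat) (s : seq bool) : bool :=
  ~~ dies up0 y s && (a <= ups up0 s)%N.

(** The tolerance delta covers the error of up to K jumps plus one cell c h; this spare cell is why
    y may be rounded down in the barrier condition. *)
Lemma tail_event_le_walk (m K a y : nat) (e x delta : R) : (0 < m)%N ->
  c * (t / m%:R) * (2 * K%:R + 1) <= delta ->
  e + delta - c * (t / m%:R) <= y%:R * (c * (t / m%:R)) ->
  c * (t / m%:R) * (2 * a%:R - m%:R) < x - delta ->
  (P (tail_event v0 e x) <=
   (2^-1 * bern (turn_prob P N (t / m%:R)) m (survive y a.+1))%:E + P (many K))%E.
Proof.
move=> m0; set h := t / m%:R => hK hy ha.
have h0 : 0 < h by rewrite divr_gt0// ltr0n.
have hm : h * m%:R = t by rewrite /h divfK// pnatr_eq0 -lt0n.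
have ch0 : 0 < c * h by rewrite mulr_gt0.
have [mS <-] := bits_law driver h0 m (survive y a.+1) Pv0.
apply: le_trans (measureU2 _ mS (measurable_many K)).
apply: le_measure; rewrite ?inE; [exact: measurable_tail_event|exact: measurableU|].
move=> w [[Vw mw] xw]; have [NK|NK] := ltnP K (N t w); [by right|left].
split => //.
have NK' : (N t w)%:R <= K%:R :> R by rewrite ler_nat.
have err : 2 * c * h * (N t w)%:R + c * h <= delta.
  by apply: le_trans hK; have := ler_wpM2l (ltW ch0) NK'; lra.
have V : V0 w = if up0 then c else - c by [].
have := @walk_of_path R (N^~ w) (@N_homo w) (V0 w) h h0 c up0 V c_gt0
  (poisson_start poissonN w) m a y e x.
rewrite hm; apply.
- by lra.
- by lra.
- exact: mw.
- exact: xw.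
Qed.

Lemma walk_le_tail_event (m K a y : nat) (e x delta : R) : (0 < m)%N ->
  c * (t / m%:R) * (2 * K%:R + 1) <= delta ->
  y%:R * (c * (t / m%:R)) <= e ->
  x <= c * (t / m%:R) * (2 * a%:R - m%:R) ->
  ((2^-1 * bern (turn_prob P N (t / m%:R)) m (survive y a))%:E <=
   P (tail_event v0 (e + delta) (x - delta)) + P (many K))%E.
Proof.
move=> m0; set h := t / m%:R => hK hy ha.
have h0 : 0 < h by rewrite divr_gt0// ltr0n.
have hm : h * m%:R = t by rewrite /h divfK// pnatr_eq0 -lt0n.
have ch0 : 0 < c * h by rewrite mulr_gt0.
have [mS <-] := bits_law driver h0 m (survive y a) Pv0.
apply: le_trans (measureU2 _ (measurable_tail_event _ _ _) (measurable_many K)).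
apply: le_measure; rewrite ?inE; [by []|
  by apply: measurableU => //; exact: measurable_tail_event|].
move=> w [Vw sw]; have [NK|NK] := ltnP K (N t w); [by right|left].
have NK' : (N t w)%:R <= K%:R :> R by rewrite ler_nat.
have err : 2 * c * h * (N t w)%:R + c * h <= delta.
  by apply: le_trans hK; have := ler_wpM2l (ltW ch0) NK'; lra.
have V : V0 w = if up0 then c else - c by [].
have := @path_of_walk R (N^~ w) (@N_homo w) (V0 w) h h0 c up0 V c_gt0
  (poisson_start poissonN w) m a y e x hy ha sw.
rewrite hm => -[h1 h2]; split; first split => //.
- by apply: le_trans h1; rewrite lerN2; lra.
- by apply: le_trans h2; lra.
Qed.

Let L := lam * t.
Local Notation ups_scale := (ups_scale lam c t).
Local Notation height_scale := (height_scale lam c).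

(** Both strict inequalities are used: a mu < w gives a + 1 <= m, and eta < (y + 1) mu gives b <= a
    + 1 + y, the condition for the reflection formula. *)
Lemma exists_lattice_point (m : nat) (mu w eta : R) :
  0 < mu -> 0 < w <= m%:R * mu -> 0 <= eta -> m%:R * mu <= 2 * w + eta ->
  exists a b y, [/\ (a.+1 + b = m)%N, (b <= a.+1 + y)%N,
    a%:R * mu < w <= a.+1%:R * mu & y%:R * mu <= eta < y.+1%:R * mu].
Proof.
move=> mu0 /andP[w0 wm] eta0 mw.
have wmu0 : 0 <= w / mu by rewrite divr_ge0// ltW.
have emu0 : 0 <= eta / mu by rewrite divr_ge0// ltW.
have [a /andP[aw wa]] : exists a : nat, a%:R * mu < w <= a.+1%:R * mu.
  have := truncn_itv wmu0; case: (Num.truncn _) => [|k] /andP[].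
    move=> _; rewrite ltr_pdivrMr// => h.
    by exists 0%N; rewrite mul0r w0 ltW.
  rewrite ler_pdivlMr// ltr_pdivrMr// le_eqVlt => /predU1P[<-|h1] h2.
    by exists k; rewrite lexx andbT ltr_pM2r// ltr_nat.
  by exists k.+1; rewrite h1 ltW.
have := truncn_itv emu0; set y := Num.truncn _.
rewrite ler_pdivlMr// ltr_pdivrMr// => /andP[ye ey].
have am : (a.+1 <= m)%N.
  by rewrite -(ltr_nat R) -(ltr_pM2r mu0) (lt_le_trans aw).
exists a, (m - a.+1)%N, y; split; [by rewrite subnKC| |by rewrite aw|by rewrite ye].
rewrite leq_subLR.
have : m%:R * mu < (2 * a.+1 + y.+1)%:R * mu by rewrite natrD natrM; lra.
by rewrite ltr_pM2r// ltr_nat; clear; lia.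
Qed.

Lemma exists_mesh (A B da db : R) : 0 <= A -> 0 <= B -> 0 < da -> 0 < db ->
  exists2 m, (0 < m)%N & A / m%:R <= da /\ B / m%:R <= db.
Proof.
move=> A0 B0 da0 db0.
have hA : 0 <= A / da by rewrite divr_ge0// ltW.
have hB : 0 <= B / db by rewrite divr_ge0// ltW.
have := truncn_itv (addr_ge0 hA hB); set k := Num.truncn _ => /andP[_ h].
exists k.+1 => //; split.
  by rewrite ler_pdivrMr// [leRHS]mulrC -ler_pdivrMr//; lra.
by rewrite ler_pdivrMr// [leRHS]mulrC -ler_pdivrMr//; lra.
Qed.

(** The upper bound is obtained directly at (e, x). A surviving walk only gives a path in the event
    enlarged by delta, so the lower bound is first proved for these events and then carried over by
    continuity from above along delta = 1 / (k + 1). *)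
Lemma tail_event_squeeze (e x F C1 C2 : R) :
  0 <= e < c * t -> - e <= x <= c * t -> 0 <= C1 -> 0 <= C2 ->
  (forall delta m a b y, 0 < delta -> e + delta < c * t ->
     (a.+1 + b = m)%N -> (b <= a.+1 + y)%N ->
     a%:R * (L / m%:R) <= ups_scale (x - delta) <= a.+1%:R * (L / m%:R) ->
     y%:R * (L / m%:R) <= height_scale (e + delta) <= y.+1%:R * (L / m%:R) ->
     bern (turn_prob P N (t / m%:R)) m (survive y a.+1) <=
       F + C1 * delta + C2 * (L / m%:R)) ->
  (forall m a b y, (a.+1 + b = m)%N -> (b <= a.+1 + y)%N ->
     a%:R * (L / m%:R) <= ups_scale x <= a.+1%:R * (L / m%:R) ->
     y%:R * (L / m%:R) <= height_scale e <= y.+1%:R * (L / m%:R) ->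
     F - C2 * (L / m%:R) <= bern (turn_prob P N (t / m%:R)) m (survive y a.+1)) ->
  P (tail_event v0 e x) = (2^-1 * F)%:E.
Proof.
move=> /andP[e0 ect] /andP[ex xct] C10 C20 upper lower.
have ct0 : 0 < c * t by rewrite mulr_gt0.
have L0 : 0 < L by rewrite mulr_gt0.
have lc0 : 0 < lam / c by rewrite divr_gt0.
have upsE z : ups_scale z = lam / c * (c * t + z) / 2 by exact: ups_scaleE.
have heightE z : height_scale z = lam / c * z by exact: height_scaleE.
have LE : L = lam / c * (c * t) by rewrite /L; field; rewrite gt_eqF.
have lattice (m : nat) z e' : (0 < m)%N -> 0 <= e' < c * t -> - e' <= z <= c * t ->
    exists a b y, [/\ (a.+1 + b = m)%N, (b <= a.+1 + y)%N,
      a%:R * (L / m%:R) < ups_scale z <= a.+1%:R * (L / m%:R) &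
      y%:R * (L / m%:R) <= height_scale e' < y.+1%:R * (L / m%:R)].
  move=> m0 /andP[e'0 e'ct] /andP[ez zct].
  have mL : m%:R * (L / m%:R) = L by rewrite mulrC divfK// pnatr_eq0 -lt0n.
  apply: exists_lattice_point; rewrite ?mL.
  - by rewrite divr_gt0// ltr0n.
  - rewrite upsE LE; apply/andP; split.
      by rewrite divr_gt0// mulr_gt0//; lra.
    by rewrite -mulrA ler_pM2l//; lra.
  - by rewrite heightE mulr_ge0// ltW.
  - rewrite upsE heightE LE.
    have -> : 2 * (lam / c * (c * t + z) / 2) + lam / c * e' =
      lam / c * (c * t + z + e') by field; rewrite gt_eqF.
    by rewrite ler_pM2l//; lra.
(* Converts lattice inequalities in the scale L / m of Poisson means into
   inequalities in the scale c t / m of positions. *)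
have ups_conv (m : nat) z (a : nat) : (0 < m)%N ->
    c * (t / m%:R) * (2 * a%:R - m%:R) - z =
    2 * (c / lam) * (a%:R * (L / m%:R) - ups_scale z).
  move=> m0; rewrite upsE LE; field.
  by rewrite pnatr_eq0 -lt0n m0 !gt_eqF.
have height_conv (m : nat) z (y : nat) : (0 < m)%N ->
    y%:R * (c * (t / m%:R)) - z =
    (c / lam) * (y%:R * (L / m%:R) - height_scale z).
  move=> m0; rewrite heightE LE; field.
  by rewrite pnatr_eq0 -lt0n m0 !gt_eqF.
have cl0 : 0 < c / lam by rewrite divr_gt0.
have mesh K da (eps : R) : 0 < da -> 0 < eps -> exists2 m, (0 < m)%N &
    c * (t / m%:R) * (2 * K%:R + 1) <= da /\ C2 * (L / m%:R) <= eps.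
  move=> da0 eps0.
  have [||m m0 [h1 h2]] :=
    @exists_mesh (c * t * (2 * K%:R + 1)) (C2 * L) da eps _ _ da0 eps0.
  - by rewrite mulr_ge0 ?(ltW ct0)// addr_ge0// mulr_ge0.
  - by rewrite mulr_ge0// ltW.
  exists m => //; split; last by rewrite mulrA.
  by rewrite (_ : _ * _ = c * t * (2 * K%:R + 1) / m%:R)//; ring.
apply/eqP; rewrite eq_le; apply/andP; split.
- apply/lee_addgt0Pr => eps eps0.
  (* The first choice makes C1 delta at most eps / 2, the second keeps e + delta below c t. *)
  pose delta := Num.min (eps / (2 * (C1 + 1))) ((c * t - e) / 2).
  have d0 : 0 < delta by rewrite lt_min !divr_gt0//; lra.
  have dl : delta <= (c * t - e) / 2 by rewrite ge_min lexx orbT.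
  have dr : C1 * delta <= eps / 2.
    have : delta <= eps / (2 * (C1 + 1)) by rewrite ge_min lexx.
    rewrite ler_pdivlMr; last by lra.
    by have := ltW d0; nra.
  have [K PK] := @many_small (eps / 4) ltac:(lra).
  have [m m0 [hK hC]] := mesh K delta (eps / 2) d0 ltac:(lra).
  have [a [b [y [abm bay aw ye]]]] := lattice m (x - delta) (e + delta) m0
    ltac:(lra) ltac:(lra).
  have := upper delta m a b y d0 ltac:(lra) abm bay.
  case/andP: aw => aw wa; case/andP: ye => ye ey.
  rewrite (ltW aw) wa ye (ltW ey) => /(_ isT isT) bu.
  apply: le_trans (tail_event_le_walk m0 hK (a := a) (y := y) _ _) _.
  - have : 0 < y.+1%:R * (c * (t / m%:R)) - (e + delta).
      by rewrite height_conv// mulr_gt0// subr_gt0.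
    by rewrite -(natr1 y); lra.
  - have : c * (t / m%:R) * (2 * a%:R - m%:R) - (x - delta) < 0.
      by rewrite ups_conv// pmulr_rlt0 ?subr_lt0// mulr_gt0.
    by rewrite subr_lt0.
  apply: le_trans (leeD (lexx _) PK) _.
  by rewrite -!EFinD lee_fin; lra.
- have low delta : 0 < delta ->
      ((2^-1 * F)%:E <= P (tail_event v0 (e + delta) (x - delta)))%E.
    move=> d0; apply/lee_addgt0Pr => eps eps0.
    have [K PK] := @many_small (eps / 2) ltac:(lra).
    have [m m0 [hK hC]] := mesh K delta eps d0 eps0.
    have [a [b [y [abm bay aw ye]]]] := lattice m x e m0 ltac:(lra) ltac:(lra).
    have := lower m a b y abm bay.
    case/andP: aw => aw wa; case/andP: ye => ye ey.
    rewrite (ltW aw) wa ye (ltW ey) => /(_ isT isT) bl.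
    have h1 : y%:R * (c * (t / m%:R)) <= e.
      by rewrite -subr_le0 height_conv// pmulr_rle0// subr_le0.
    have h2 : x <= c * (t / m%:R) * (2 * a.+1%:R - m%:R).
      by rewrite -subr_ge0 ups_conv// mulr_ge0 ?subr_ge0// mulr_ge0// ltW.
    have := walk_le_tail_event m0 hK h1 h2 => h3.
    have : ((2^-1 * F - eps / 2)%:E <=
        P (tail_event v0 (e + delta) (x - delta)) + (eps / 2)%:E)%E.
      apply: le_trans (le_trans h3 (leeD (lexx _) PK)).
      by rewrite lee_fin; lra.
    rewrite -[P _]fineK ?fin_num_measure//; last exact: measurable_tail_event.
    by rewrite -!EFinD !lee_fin; lra.
  pose Ek k := tail_event v0 (e + k.+1%:R^-1) (x - k.+1%:R^-1).
  have mE k : measurable (Ek k) by exact: measurable_tail_event.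
  rewrite (_ : tail_event v0 e x = \bigcap_k Ek k); last first.
    have inv0 k : 0 <= k.+1%:R^-1 :> R by rewrite invr_ge0.
    apply/seteqP; split => [w [[Vw mw] xw] k _|w H].
      rewrite /Ek; split; [split => //|].
        by apply: le_trans mw; rewrite lerN2 lerDl.
      by apply: le_trans xw; rewrite gerBl.
    have small eps : 0 < eps -> exists k : nat, k.+1%:R^-1 <= eps :> R.
      move=> eps0; have ei0 : 0 <= eps^-1 by rewrite invr_ge0 ltW.
      have := truncn_itv ei0; set k := Num.truncn _ => /andP[_ h]; exists k.
      by rewrite invf_ple ?posrE// ltW.
    split; first split.
    - by have [[]] := H 0%N I.
    - apply/ler_addgt0Pr => eps /small[k keps].
      have [[_ h] _] := H k I; rewrite -lerBlDr; apply: le_trans h.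
      by rewrite opprD lerD2l lerN2.
    - apply/ler_addgt0Pr => eps /small[k keps].
      have [[_ _] h] := H k I; rewrite -lerBlDr; apply: le_trans h.
      by rewrite lerD2l lerN2.
  have cE : P \o Ek @ \oo --> P (\bigcap_k Ek k).
    apply: nonincreasing_cvg_mu.
    - by rewrite ltey_eq fin_num_measure.
    - exact: mE.
    - exact: bigcapT_measurable.
    - move=> i j ij; apply/subsetPset => w [[Vw mw] xw].
      have h : j.+1%:R^-1 <= i.+1%:R^-1 :> R by rewrite lef_pV2 ?posrE// ler_nat.
      split; [split => //|].
        by apply: le_trans mw; rewrite lerN2 lerD2l.
      by apply: le_trans xw; rewrite lerD2l lerN2.
  rewrite -(cvg_lim _ cE)//; apply: lime_ge; first by apply: cvgP cE.
  by apply: nearW => k; apply: low; rewrite invr_gt0.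
Qed.

End Tails.

(** * Closed forms of the tail probabilities *)

Section TailFormulas.
Context (R : realType) (d : measure_display) (W : measurableType d).
Variables (P : probability W R) (lam c t : R) (N : R -> W -> nat) (V0 : W -> R).
Hypotheses (lam_gt0 : 0 < lam) (c_gt0 : 0 < c) (t_gt0 : 0 < t).
Hypothesis driver : telegraph_driver P lam c N V0.

Let L := lam * t.

Local Notation ups_scale := (ups_scale lam c t).
Local Notation height_scale := (height_scale lam c).

Let lc0 : 0 < lam / c. Proof. by rewrite divr_gt0. Qed.

Let LE : L = lam / c * (c * t).
Proof. by rewrite /L; field; rewrite gt_eqF. Qed.

Lemma ups_scale_itv x : - (c * t) <= x <= c * t -> 0 <= ups_scale x <= lam * t.
Proof.
rewrite -/L LE ups_scaleE// => /andP[x1 x2]; apply/andP; split.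
  by rewrite divr_ge0// mulr_ge0 ?(ltW lc0)//; lra.
by rewrite -mulrA ler_pM2l//; lra.
Qed.

Let mesh_bounds (m : nat) : (0 < m)%N -> [/\ 0 <= turn_prob P N (t / m%:R) <= 1,
  0 < L / m%:R,
  L / m%:R - (L / m%:R) ^+ 2 <= turn_prob P N (t / m%:R) <= L / m%:R &
  m%:R * (L / m%:R) = L].
Proof.
move=> m0; have h0 : 0 < t / m%:R by rewrite divr_gt0// ltr0n.
split.
- exact: turn_prob01 driver _ h0.
- by rewrite divr_gt0 ?ltr0n// mulr_gt0.
- by rewrite -mulrA; exact: turn_prob_bounds lam_gt0 driver _ h0.
- by rewrite mulrC divfK// pnatr_eq0 -lt0n.
Qed.

Let ups_scale_shift x delta :
  ups_scale (x - delta) = ups_scale x - lam / c * delta / 2.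
Proof. by rewrite !ups_scaleE//; ring. Qed.

Let ups_scale_diff x delta :
  ups_scale (x - delta) - ups_scale x = - (lam / c * delta / 2).
Proof. by rewrite ups_scale_shift; ring. Qed.

(** In the constant 3 lam / c, the Lipschitz constant 4 of [sk01] times the shift lam delta / (2 c)
    accounts for 2, and the cost p y of a barrier at - delta for 1. *)
Lemma tail_event_up (x : R) : 0 <= x <= c * t ->
  P (tail_event t N V0 c 0 x) = (2^-1 * sk01 L (ups_scale x))%:E.
Proof.
move=> /andP[x0 xct].
have ct0 : 0 < c * t by rewrite mulr_gt0.
have L0 : 0 < L by rewrite mulr_gt0.
have wL : 0 <= ups_scale x <= L by apply: ups_scale_itv; lra.
apply: (@tail_event_squeeze _ _ _ P lam c t N V0 lam_gt0 c_gt0 t_gt0 driver true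
  0 x _ (3 * (lam / c)) (20 * L + 4)).
- by rewrite lexx.
- by rewrite oppr0 x0.
- by rewrite mulr_ge0// ltW.
- by lra.
- move=> delta m a b y d0 ed abm bay aw /andP[ye _].
  have m0 : (0 < m)%N by rewrite -abm.
  have [p01 mu0 pmu mL] := mesh_bounds m0.
  have wL' : 0 <= ups_scale (x - delta) <= L by apply: ups_scale_itv; lra.
  have := survives_up_approx_le p01 (ltW mu0) pmu mL abm bay wL' aw ye.
  have := sk01_lipschitz wL' wL; rewrite ups_scale_diff normrN.
  have ld : 0 <= lam / c * delta / 2 by rewrite divr_ge0// mulr_ge0 ?ltW.
  rewrite (ger0_norm ld) ler_norml => /andP[_ h1].
  rewrite add0r -/(survive true y a.+1).
  rewrite height_scaleE.
  rewrite -(mulrA 3).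
  move: h1; move: (lam / c * delta) ((20 * L + 4) * _) => q M h1 h2.
  by apply: le_trans h2 _; lra.
- move=> m a b y abm bay aw /andP[ye _].
  have m0 : (0 < m)%N by rewrite -abm.
  have [p01 mu0 pmu mL] := mesh_bounds m0.
  have y0 : y = 0%N.
    move: ye; rewrite height_scaleE mulr0 pmulr_lle0//.
    by rewrite -[0]/(0%:R) ler_nat leqn0 => /eqP.
  rewrite y0 addn0 in bay *.
  have := survives_up_approx p01 (ltW mu0) pmu mL abm bay wL aw.
  rewrite ler_norml => /andP[+ _]; rewrite /survive.
  by move: ((20 * L + 4) * _) => M h; lra.
Qed.

Variable J : R -> R.
Hypothesis derJ : forall z, 0 <= z <= L -> is_derive z 1 J (sk01 L z).

(** A move by 2 e in position is a move by [height_scale e] in the scale of [J]. The constant 2 lam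
    / c arises because [J] is 2-Lipschitz and each of its two arguments moves by at most lam delta /
    (2 c). *)
Lemma tail_event_down (e x : R) : 0 <= e < c * t -> - e <= x <= c * t ->
  P (tail_event t N V0 (- c) e x) =
  (2^-1 * (J (ups_scale (Num.min (x + 2 * e) (c * t))) - J (ups_scale x)))%:E.
Proof.
move=> /andP[e0 ect] /andP[ex xct].
have ct0 : 0 < c * t by rewrite mulr_gt0.
have L0 : 0 < L by rewrite mulr_gt0.
have minE z e' : ups_scale (Num.min (z + 2 * e') (c * t)) =
    Num.min (ups_scale z + height_scale e') L.
  have h : ups_scale z + height_scale e' - L = lam / c / 2 * (z + 2 * e' - c * t).
    by rewrite ups_scaleE// LE !height_scaleE; field; rewrite gt_eqF.
  have h' : ups_scale (z + 2 * e') = ups_scale z + height_scale e'.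
    by rewrite !ups_scaleE// !height_scaleE; field; rewrite gt_eqF.
  have hL : ups_scale (c * t) = L by rewrite ups_scaleE// LE; field; rewrite gt_eqF.
  have lc20 : 0 < lam / c / 2 by rewrite divr_gt0.
  have [le|lt] := leP (z + 2 * e') (c * t).
    rewrite h'; apply/esym/min_l; rewrite -subr_le0 h pmulr_rle0//.
    by rewrite subr_le0.
  rewrite hL; apply/esym/min_r; rewrite -subr_ge0 h mulr_ge0 ?(ltW lc20)//.
  by rewrite subr_ge0 ltW.
rewrite minE.
have wL : 0 <= ups_scale x <= L by apply: ups_scale_itv; lra.
have eta0 e' : 0 <= e' -> 0 <= height_scale e'.
  by move=> ?; rewrite height_scaleE mulr_ge0// ltW.
have mL' w eta : 0 <= w -> 0 <= eta -> 0 <= Num.min (w + eta) L <= L.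
  by move=> w0 n0; rewrite ge_min lexx orbT andbT le_min (ltW L0) andbT addr_ge0.
have C20 : 0 <= L * (20 * L + 10) + 6.
  by rewrite addr_ge0// mulr_ge0 ?(ltW L0)//; lra.
apply: (@tail_event_squeeze _ _ _ P lam c t N V0 lam_gt0 c_gt0 t_gt0 driver false
  e x _ (2 * (lam / c)) (L * (20 * L + 10) + 6)) => //.
- by rewrite e0.
- by rewrite ex.
- by rewrite mulr_ge0// ltW.
- move=> delta m a b y d0 ed abm bay aw ye.
  have m0 : (0 < m)%N by rewrite -abm.
  have [p01 mu0 pmu mL] := mesh_bounds m0.
  have wL' : 0 <= ups_scale (x - delta) <= L by apply: ups_scale_itv; lra.
  have ed0 : 0 <= e + delta by lra.
  have := survives_down_approx derJ p01 (ltW mu0) pmu mL abm bay wL'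
    (eta0 _ ed0) aw ye.
  rewrite ler_norml => /andP[_ h].
  have /andP[w'0 _] := wL'; have /andP[w0 _] := wL.
  have := J_lipschitz derJ wL' wL.
  have := J_lipschitz derJ (mL' _ _ w'0 (eta0 _ ed0)) (mL' _ _ w0 (eta0 _ e0)).
  have ld : 0 <= lam / c * delta by rewrite mulr_ge0 ?ltW.
  have : `|Num.min (ups_scale (x - delta) + height_scale (e + delta)) L -
      Num.min (ups_scale x + height_scale e) L| <= lam / c * delta / 2.
    have -> : ups_scale (x - delta) + height_scale (e + delta) =
        ups_scale x + height_scale e + lam / c * delta / 2.
      by rewrite ups_scale_shift !height_scaleE; field; rewrite gt_eqF.
    move: (ups_scale x + height_scale e) (lam / c * delta) ld => z q ld.
    rewrite ler_norml; case: (leP (z + q / 2) L) => ?; case: (leP z L) => ?;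
      by apply/andP; split; lra.
  have : `|ups_scale (x - delta) - ups_scale x| <= lam / c * delta / 2.
    rewrite ups_scale_diff normrN ger0_norm//.
    by rewrite divr_ge0.
  rewrite -(mulrA 2); move: ld h; rewrite /survive.
  move: (lam / c * delta) ((L * _ + 6) * _) => q M ld h h1 h2 h3 h4.
  have := le_trans h3 (ler_wpM2l (_ : 0 <= 2) h2).
  have := le_trans h4 (ler_wpM2l (_ : 0 <= 2) h1).
  rewrite ler0n !ler_norml => /(_ isT)/andP[? ?] /(_ isT)/andP[? ?].
  by lra.
- move=> m a b y abm bay aw ye.
  have m0 : (0 < m)%N by rewrite -abm.
  have [p01 mu0 pmu mL] := mesh_bounds m0.
  have := survives_down_approx derJ p01 (ltW mu0) pmu mL abm bay wL (eta0 _ e0) aw ye.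
  rewrite ler_norml => /andP[+ _]; rewrite /survive.
  by move: ((L * _ + 6) * _) => M h; lra.
Qed.

Lemma telegraph_le (s : R) w : 0 <= s -> `|telegraph N V0 s w| <= `|V0 w| * s.
Proof.
have [poissonN _ _] := driver => s0.
have := @signed_path_lipschitz _ (N^~ w) (poisson_homo poissonN w) (V0 w) 0 s (lexx 0) s0.
by rewrite signed_path0 !subr0.
Qed.

End TailFormulas.

(** * Measures and densities on the line *)

Section MeasureLemmas.
Context (R : realType).
Local Notation mu := (@lebesgue_measure R).

(** Closed right rays form a pi-system generating the Borel sets, and the rays from - k have finite
    mass and exhaust the line. *)
Lemma measure_eq_rays (m1 m2 : {measure set (measurableTypeR R) -> \bar R}) :
  (forall x : R, m1 `[x, +oo[ = m2 `[x, +oo[)%classic ->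
  (forall x : R, (m1 `[x, +oo[%classic < +oo)%E) ->
  forall A, measurable A -> m1 A = m2 A.
Proof.
move=> m12 m1oo A mA.
apply: (@measure_unique _ _ (measurableTypeR R) (@RGenCInfty.G R)
  (fun k : nat => `[(- k%:R : R), +oo[%classic)) => //.
- exact: RGenCInfty.measurableE.
- move=> _ _ [x ->] [y ->]; exists (Num.max x y).
  by apply/seteqP; split => z /=; rewrite !in_itv/= !andbT ge_max => /andP.
- by move=> k; eexists.
- apply/seteqP; split => // z _; exists (Num.truncn `|z|).+1 => //=.
  rewrite in_itv/= andbT lerNl.
  have /andP[_ /ltW] := truncn_itv (normr_ge0 z).
  by apply: le_trans; rewrite -normrN ler_norm.
- by move=> _ [x ->]; exact: m12.
Qed.

(* As in mrestr, the proofs are arguments so that the measure structure can be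
   inferred. *)
Definition density_measure (f : R -> R) (mf : measurable_fun setT f)
    (f0 : forall x, 0 <= f x) (A : set (measurableTypeR R)) : \bar R :=
  \int[mu]_(x in A) (f x)%:E.

Section DensityMeasure.
Variables (f : R -> R) (mf : measurable_fun setT f) (f0 : forall x, 0 <= f x).
Local Notation m := (density_measure mf f0).

Let density0 : m set0 = 0%E.
Proof. by rewrite /density_measure integral_set0. Qed.

Let density_ge0 A : (0 <= m A)%E.
Proof. by apply: integral_ge0 => x _; rewrite lee_fin. Qed.

Let density_sigma_additive : semi_sigma_additive m.
Proof.
by apply: semi_sigma_additive_nng_induced => //; exact/measurable_EFinP.
Qed.

HB.instance Definition _ := isMeasure.Build _ _ _ m
  density0 density_ge0 density_sigma_additive.

End DensityMeasure.

Definition restricted_law (d : measure_display) (W : measurableType d)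
    (P : {measure set W -> \bar R}) (D : set W) (X : W -> R)
    (mD : measurable D) (mX : measurable_fun setT X)
    (A : set (measurableTypeR R)) : \bar R := P (X @^-1` A `&` D).

Section RestrictedLaw.
Context (d : measure_display) (W : measurableType d).
Variables (P : {measure set W -> \bar R}) (D : set W) (X : W -> R).
Variables (mD : measurable D) (mX : measurable_fun setT X).
Local Notation m := (restricted_law P mD mX).

Let mXD A : measurable A -> measurable (X @^-1` A `&` D).
Proof.
by move=> mA; apply: measurableI => //; rewrite -[X in measurable X]setTI; exact: mX.
Qed.

Let law0 : m set0 = 0%E.
Proof. by rewrite /restricted_law preimage_set0 set0I measure0. Qed.

Let law_ge0 A : (0 <= m A)%E. Proof. exact: measure_ge0. Qed.

Let law_sigma_additive : semi_sigma_additive m.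
Proof.
move=> F mF tF mU; rewrite /restricted_law preimage_bigcup setI_bigcupl.
apply: measure_semi_sigma_additive.
- by move=> n; apply: mXD; exact: mF.
- apply/trivIsetP => i j _ _ ij; rewrite setIACA -preimage_setI.
  by move/trivIsetP : tF => /(_ _ _ I I ij) ->; rewrite preimage_set0 set0I.
- by rewrite -setI_bigcupl -preimage_bigcup; apply: mXD; exact: mU.
Qed.

HB.instance Definition _ := isMeasure.Build _ _ _ m
  law0 law_ge0 law_sigma_additive.

End RestrictedLaw.

Lemma integral_patch_ray (g G : R -> R) (a b x : R) : a <= b -> continuous g ->
  (forall z, a <= z <= b -> is_derive z 1 G (g z)) ->
  (\int[mu]_(z in `[x, +oo[) ((g \_ `[a, b[) z)%:E =
   (G b - G (Num.max a (Num.min x b)))%:E)%E.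
Proof.
move=> ab cg derG; set x' := Num.max a (Num.min x b).
have ax' : a <= x' by rewrite le_max lexx.
have x'b : x' <= b by rewrite ge_max ab ge_min lexx orbT.
transitivity (\int[mu]_(z in `[x, +oo[ `&` `[a, b[) (g z)%:E)%E.
  rewrite [RHS]integral_mkcondr; apply: eq_integral => z _.
  by rewrite !patchE; case: ifP.
rewrite (_ : `[x, +oo[ `&` `[a, b[ = `[x', b[)%classic; last first.
  apply/seteqP; split => z /=; rewrite !in_itv/= andbT.
    by move=> [xz /andP[az zb]]; rewrite zb andbT ge_max az ge_min xz.
  rewrite ge_max ge_min => /andP[/andP[az /orP[xz|bz]] zb]; first by rewrite az zb.
  by move: zb; rewrite ltNge bz.
have [x'b'|x'b'|<-] := ltgtP x' b.
- rewrite integral_itv_bndo_bndc; last first.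
    apply/measurable_EFinP/measurable_funTS.
    exact: continuous_measurable_fun.
  rewrite (continuous_FTC2 x'b' (F := G)) ?EFinB//.
  + exact: continuous_subspaceT.
  + split.
    * move=> z; rewrite in_itv/= => /andP[x'z zb].
      by have [] := derG z ltac:(by rewrite (le_trans ax' (ltW x'z)) (ltW zb)).
    * apply: cvg_at_right_filter; apply/differentiable_continuous.
      by apply/derivable1_diffP; have [] := derG x' ltac:(by rewrite ax' x'b).
    * apply: cvg_at_left_filter; apply/differentiable_continuous.
      by apply/derivable1_diffP; have [] := derG b ltac:(by rewrite ab lexx).
  + move=> z; rewrite in_itv/= => /andP[x'z zb].
    have D := derG z ltac:(by rewrite (le_trans ax' (ltW x'z)) (ltW zb)).
    by rewrite derive1E (@derive_val _ _ _ _ _ _ _ D).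
- by move: x'b; rewrite leNgt x'b'.
- by rewrite subrr set_itv_ge ?integral_set0// bnd_simp ltxx.
Qed.

Lemma continuous_within_eq (A : set R) (f g : R -> R) : continuous g ->
  (forall x, A x -> f x = g x) -> {within A, continuous f}.
Proof.
move=> cg fg; apply: (@subspace_eq_continuous _ _ _ g).
  by move=> x /set_mem Ax; exact/esym/fg.
exact: continuous_subspaceT.
Qed.

Lemma within_itv_near (f : R -> R) (b x e : R) : 0 <= x < b ->
  {within `[0, b[, continuous f} -> 0 < e ->
  exists2 h, 0 < h & forall y, x <= y < x + h -> y < b /\ `|f x - f y| < e.
Proof.
move=> /andP[x0 xb] /subspace_continuousP cf e0.
have := cf x; rewrite /= in_itv/= x0 xb => /(_ isT)/cvgrPdist_lt/(_ e e0).
rewrite /within /= => /nbhs_ballP[h /= h0 hP].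
exists (Num.min h (b - x)); first by rewrite lt_min h0 subr_gt0.
move=> y /andP[xy yx].
have yb : y < b by move: yx; rewrite -ltrBlDl lt_min => /andP[_]; rewrite ltrD2r.
split => //; apply: hP; rewrite /ball /=.
  rewrite distrC ger0_norm ?subr_ge0//.
  by move: yx; rewrite -ltrBlDl lt_min => /andP[].
by rewrite in_itv/= yb (le_trans x0).
Qed.

(** If q1 x < q2 x, a gap persists on an interval to the right of x. Removing the null sets that
    carry the singular parts keeps its length, and there m would have two integrals that differ. *)
Lemma ac_density_unique (m : set R -> \bar R) (q1 q2 : R -> R) (b x : R) :
  is_ac_density m q1 -> is_ac_density m q2 ->
  {within `[0, b[, continuous q1} -> {within `[0, b[, continuous q2} ->
  0 <= x < b -> q1 x = q2 x.
Proof.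
wlog q12 : q1 q2 / q1 x < q2 x => [hw ac1 ac2 c1 c2 xb|].
  have [lt12|lt21|//] := ltgtP (q1 x) (q2 x); first exact: hw.
  by apply/esym; exact: hw.
move=> [mq1 q10 [nu1 [S1 [mS1 S10 nuS1]] m1]] [mq2 q20 [nu2 [S2 [mS2 S20 nuS2]] m2]].
(* A quarter of the gap: an error of e for each function still leaves more than e between them. *)
move=> c1 c2 xb; exfalso; pose e := (q2 x - q1 x) / 4.
have e0 : 0 < e by rewrite divr_gt0// subr_gt0.
have [h1 h10 H1] := within_itv_near xb c1 e0.
have [h2 h20 H2] := within_itv_near xb c2 e0.
pose h := Num.min h1 h2; have h0 : 0 < h by rewrite lt_min h10.
pose A := `[x, x + h[%classic `\` (S1 `|` S2).
have mI : measurable (`[x, x + h[%classic : set R) by [].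
have mA : measurable A by apply: measurableD => //; exact: measurableU.
have q12A y : A y -> q1 y + e <= q2 y.
  move=> [/= + _]; rewrite in_itv/= => /andP[xy yx].
  have [_ ] := H1 y ltac:(by rewrite xy (lt_le_trans yx)// lerD2l ge_min lexx).
  have [_ ] := H2 y ltac:(by rewrite xy (lt_le_trans yx)// lerD2l ge_min lexx orbT).
  by rewrite !ltr_norml /e => /andP[? ?] /andP[? ?]; lra.
have nuA (nu : {measure set R -> \bar R}) S : measurable S -> A `<=` ~` S ->
    nu (~` S) = 0%E -> nu A = 0%E.
  move=> mS AS nuS; apply/eqP; rewrite eq_le measure_ge0 andbT -nuS.
  by apply: le_measure; rewrite ?inE//; exact: measurableC.
have mA1 := m1 A mA; have mA2 := m2 A mA.
rewrite (nuA _ S1) ?adde0 in mA1 => //; last by move=> y [_ nS] S1y; apply: nS; left.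
rewrite (nuA _ S2) ?adde0 in mA2 => //; last by move=> y [_ nS] S2y; apply: nS; right.
have muA : mu A = h%:E.
  have -> : mu A = mu `[x, x + h[%classic.
    rewrite /A measureD//=; last 2 first.
    - exact: measurableU.
    - by rewrite lebesgue_measure_itv/= lte_fin ltrDl h0 -EFinD ltry.
    rewrite (_ : mu (_ `&` _) = 0%E) ?sube0//; apply/eqP.
    rewrite eq_le measure_ge0 andbT.
    apply: (@le_trans _ _ (mu (S1 `|` S2))).
      by apply: le_measure; rewrite ?inE//; [apply: measurableI => //|];
        exact: measurableU.
    have := measureU2 mu mS1 mS2.
    by rewrite [X in (_ <= X)%E](_ : _ = 0%E)//= S10 S20 adde0.
  by rewrite lebesgue_measure_itv/= lte_fin ltrDl h0 -EFinD addrAC subrr add0r.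
(* Finiteness allows the integral to be cancelled in the extended reals. *)
have fin : (\int[mu]_(y in A) (q1 y)%:E < +oo)%E.
  have q1A y : A y -> q1 y <= q1 x + e.
    move=> [/= + _]; rewrite in_itv/= => /andP[xy yx].
    have [_ ] := H1 y ltac:(by rewrite xy (lt_le_trans yx)// lerD2l ge_min lexx).
    by rewrite ltr_norml => /andP[? _]; lra.
  apply: (@le_lt_trans _ _ (\int[mu]_(y in A) (cst (q1 x + e)%:E y))%E).
    apply: ge0_le_integral => //=.
    - by move=> y _; rewrite lee_fin.
    - exact/measurable_EFinP/measurable_funTS.
  by rewrite integral_cst//= muA -EFinM ltry.
have : (\int[mu]_(y in A) (q1 y)%:E + e%:E * mu A <= \int[mu]_(y in A) (q2 y)%:E)%E.
  rewrite -integral_cst// -ge0_integralD//=.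
  - apply: ge0_le_integral => //=.
    + by move=> y _; rewrite adde_ge0 ?lee_fin// ltW.
    + by apply: emeasurable_funD => //; exact/measurable_EFinP/measurable_funTS.
    + exact/measurable_EFinP/measurable_funTS.
  - by move=> y _; rewrite lee_fin.
  - exact/measurable_EFinP/measurable_funTS.
  - by move=> y _; rewrite lee_fin ltW.
rewrite muA -mA2 mA1 -[X in (X + _)%E]fineK; last first.
  by rewrite ge0_fin_numE//; apply: integral_ge0 => y _; rewrite lee_fin.
rewrite -[X in (_ <= X)%E]fineK; last first.
  by rewrite ge0_fin_numE//; apply: integral_ge0 => y _; rewrite lee_fin.
rewrite -EFinM -EFinD lee_fin gerDl leNgt.
by rewrite mulr_gt0.
Qed.

(** The factor k covers the increments 2 e, e and - e with the same right limit in e. *)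
Lemma right_difference_quotient (F : R -> R) (a l k : R) : k != 0 ->
  is_derive a 1 F l ->
  (F (a + k * e) - F a) / (k * e) @[e --> 0^'+] --> l.
Proof.
move=> k0 [dF <-].
have : h^-1 *: (F (h *: 1 + a) - F a) @[h --> 0^'] --> 'D_1 F a by [].
move=> /(@cvg_comp _ _ _ (fun e => k * e) _ (0^'+) _) h.
have {}h := h _.
apply: cvg_trans (h _).
  apply: near_eq_cvg; near=> e => /=.
  by rewrite /GRing.scale/= mulr1 (addrC a) [RHS]mulrC.
move=> Y [eps /= eps0 HY].
exists (eps / `|k|); first by rewrite /= divr_gt0// normr_gt0.
move=> e /=; rewrite /ball_ sub0r normrN => ek e0; apply: HY.
  by rewrite /ball_ /= sub0r normrN normrM mulrC -ltr_pdivlMr// normr_gt0.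
by rewrite mulf_neq0// gt_eqF.
Unshelve. all: by end_near. Qed.

End MeasureLemmas.

(** * Densities of the telegraph process *)

Section PMinus.
Context (R : realType).
Variables lam c t : R.
Hypotheses (lam_gt0 : 0 < lam) (c_gt0 : 0 < c) (t_gt0 : 0 < t).

Lemma besselIE nu (y : R) : besselI nu y = (y / 2) ^+ nu * phi nu ((y / 2) ^+ 2).
Proof.
apply: cvg_lim => //.
have h : (y / 2) ^+ nu * pseries (phi_coeff R nu) ((y / 2) ^+ 2) n @[n --> \oo] -->
    (y / 2) ^+ nu * phi nu ((y / 2) ^+ 2).
  by apply: cvgMl_tmp; exact: is_cvg_phi.
apply: cvg_trans h; apply: near_eq_cvg; apply: nearW => n.
rewrite /pseries /series /= mulr_sumr; apply: eq_bigr => k _.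
by rewrite /phi_coeff -exprM (addnC nu) exprD; ring.
Qed.

(* p_minus without its indicator, smooth across the end points of its support. *)
Definition p_ext (x : R) : R := lam / (2 * c) * sk01 (lam * t) (ups_scale lam c t x).

Definition dp_ext (x : R) : R :=
  (lam / (2 * c)) ^+ 2 * dsk01 (lam * t) (ups_scale lam c t x).

Let lc0 : 0 < lam / (2 * c). Proof. by rewrite divr_gt0// mulr_gt0. Qed.

Lemma is_derive_ups_scale (x : R) :
  is_derive x 1 (ups_scale lam c t) (lam / (2 * c)).
Proof.
rewrite (_ : ups_scale lam c t = fun x => lam / (2 * c) * x + lam * t / 2).
  by apply: is_derive_eq; rewrite /GRing.scale/=; ring.
by apply/funext => z; rewrite /ups_scale; field; rewrite gt_eqF.
Qed.

Lemma is_derive_p_ext (x : R) : is_derive x 1 p_ext (dp_ext x).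
Proof.
have h : is_derive x 1 (sk01 (lam * t) \o ups_scale lam c t)
    (dsk01 (lam * t) (ups_scale lam c t x) * (lam / (2 * c))).
  apply: is_derive1_comp; first exact: is_derive_sk01.
  exact: is_derive_ups_scale.
have hc := is_derive_cst (lam / (2 * c) : R) x (1 : R).
apply: (is_derive_eq (is_deriveM hc h)).
by rewrite /dp_ext /GRing.scale/=; ring.
Qed.

Lemma continuous_ups_scale : continuous (ups_scale lam c t).
Proof.
move=> x; apply/differentiable_continuous/derivable1_diffP.
exact: (@ex_derive _ _ _ _ _ _ _ (is_derive_ups_scale x)).
Qed.

Lemma continuous_p_ext : continuous p_ext.
Proof.
move=> x; apply/differentiable_continuous/derivable1_diffP.
exact: (@ex_derive _ _ _ _ _ _ _ (is_derive_p_ext x)).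
Qed.

Lemma continuous_dp_ext : continuous dp_ext.
Proof.
move=> x; apply: cvgM; first exact: cvg_cst.
apply: (@continuous_comp _ _ _ (ups_scale lam c t) (dsk01 (lam * t))).
  exact: continuous_ups_scale.
exact: continuous_dsk01.
Qed.

(** With L = lam t and w = [ups_scale] at x, the squared half argument of the Bessel functions is w
    (L - w), and the square-root prefactor of I_1 times this half argument is L - w. *)
Lemma p_minusE (x : R) : - (c * t) < x < c * t -> p_minus lam c t x = p_ext x.
Proof.
move=> /andP[x1 x2]; have cx1 : 0 < c * t - x by lra.
have cx2 : 0 < c * t + x by lra.
rewrite /p_minus indicE mem_set/= ?in_itv/= ?x1// mulr1 /p_ext sk01E !besselIE.
rewrite expr0 expr1 mul1r.
set y := lam / c * _; set w := ups_scale lam c t x.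
have y2 : (y / 2) ^+ 2 = w * (lam * t - w).
  rewrite /y /w ups_scaleE// !exprMn sqr_sqrtr.
    by field; rewrite gt_eqF.
  by rewrite (_ : _ - _ = (c * t - x) * (c * t + x)) ?mulr_ge0 ?ltW//; ring.
rewrite y2.
have -> : Num.sqrt ((c * t - x) / (c * t + x)) *
    (y / 2 * phi 1 (w * (lam * t - w))) = (lam * t - w) * phi 1 (w * (lam * t - w)).
  rewrite mulrA; congr (_ * _); rewrite /y.
  rewrite (_ : _ - x ^+ 2 = (c * t - x) * (c * t + x)); last by ring.
  rewrite sqrtrM ?(ltW cx1)// sqrtrV ?(ltW cx2)// sqrtrM ?(ltW cx1)//.
  have s2 : Num.sqrt (c * t + x) != 0 by rewrite gt_eqF// sqrtr_gt0.
  transitivity (lam / c / 2 * Num.sqrt (c * t - x) ^+ 2).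
    by field; rewrite s2 gt_eqF.
  rewrite sqr_sqrtr ?(ltW cx1)// /w ups_scaleE//.
  by field; rewrite gt_eqF.
by rewrite (addrC (phi 0 _)); ring.
Qed.

Lemma p_ext_gt0 (x : R) : - (c * t) <= x <= c * t -> 0 < p_ext x.
Proof.
by move=> xct; rewrite mulr_gt0// sk01_gt0//; exact: ups_scale_itv.
Qed.

Lemma p_ext_le (x y : R) : 0 <= x -> x <= y -> y <= c * t -> p_ext y <= p_ext x.
Proof.
move=> x0 xy yct; rewrite ler_wpM2l ?(ltW lc0)//.
have /andP[_ yL] : 0 <= ups_scale lam c t y <= lam * t.
  by apply: ups_scale_itv => //; have := mulr_gt0 c_gt0 t_gt0; lra.
have h0 : 0 <= lam / c by rewrite divr_ge0// ltW.
apply: sk01_le => //; rewrite !ups_scaleE//.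
  rewrite (_ : lam * t = lam / c * (c * t)); last by field; rewrite gt_eqF.
  by rewrite ler_pM2r// ler_wpM2l//; lra.
by rewrite ler_pM2r// ler_wpM2l//; lra.
Qed.

Lemma p_ext_flip_le (x : R) : 0 <= x <= c * t -> p_ext x <= p_ext (- x).
Proof.
move=> /andP[x0 xct]; rewrite ler_wpM2l ?(ltW lc0)//.
have -> : ups_scale lam c t (- x) = lam * t - ups_scale lam c t x.
  by rewrite !ups_scaleE//; field; rewrite gt_eqF.
have /andP[_ xL] : 0 <= ups_scale lam c t x <= lam * t.
  by apply: ups_scale_itv => //; have := mulr_gt0 c_gt0 t_gt0; lra.
apply: sk01_flip_le => //; rewrite !ups_scaleE//.
rewrite (_ : lam * t = lam / c * (c * t)); last by field; rewrite gt_eqF.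
by rewrite ler_pM2r// ler_wpM2l//; [rewrite divr_ge0// ltW|lra].
Qed.

Lemma dp_ext_le0 (x : R) : 0 <= x <= c * t -> dp_ext x <= 0.
Proof.
move=> /andP[x0 xct]; rewrite mulr_ge0_le0 ?exprn_ge0 ?(ltW lc0)//.
have ct0 := mulr_gt0 c_gt0 t_gt0.
have /andP[w0 wL] : 0 <= ups_scale lam c t x <= lam * t.
  by apply: ups_scale_itv => //; lra.
have : lam * t / 2 <= ups_scale lam c t x.
  rewrite ups_scaleE// (_ : lam * t = lam / c * (c * t)); last first.
    by field; rewrite gt_eqF.
  by rewrite ler_pM2r// ler_wpM2l//; [rewrite divr_ge0// ltW|lra].
move: (ups_scale _ _ _ _) w0 wL => w w0 wL wh.
have hw : 0 <= w * (lam * t - w) by rewrite mulr_ge0//; lra.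
rewrite mulr_ge0_le0 ?expR_ge0//.
have h1 : (lam * t - 2 * w - 1) * phi 1 (w * (lam * t - w)) <= 0.
  by rewrite mulr_le0_ge0 ?phi_ge0//; lra.
have h2 : (lam * t - w) * (lam * t - 2 * w) * phi 2 (w * (lam * t - w)) <= 0.
  by rewrite mulr_le0_ge0 ?phi_ge0// mulr_ge0_le0//; lra.
by lra.
Qed.

Lemma is_derive_p_minus (x : R) : - (c * t) < x < c * t ->
  is_derive x 1 (p_minus lam c t) (dp_ext x).
Proof.
move=> /andP[x1 x2]; apply: near_eq_is_derive (is_derive_p_ext x).
near=> y; apply/esym/p_minusE; apply/andP; split; near: y.
  exact: lt_nbhsr.
exact: lt_nbhsl.
Unshelve. all: by end_near. Qed.

End PMinus.

Section Densities.
Context (R : realType) (d : measure_display) (W : measurableType d).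
Variables (P : probability W R) (lam c t : R) (N : R -> W -> nat) (V0 : W -> R).
Hypotheses (lam_gt0 : 0 < lam) (c_gt0 : 0 < c) (t_gt0 : 0 < t).
Hypothesis driver : telegraph_driver P lam c N V0.
Local Notation mu := (@lebesgue_measure R).
Local Notation T := (telegraph N V0).
Local Notation tail := (tail_event t N V0).
Local Notation ups_scale := (ups_scale lam c t).
Local Notation p_ext := (p_ext lam c t).
Local Notation dp_ext := (dp_ext lam c t).

Let ct0 : 0 < c * t. Proof. exact: mulr_gt0. Qed.

Let mT : measurable_fun setT (T t).
Proof. by apply: (measurable_telegraph driver); exact: ltW. Qed.

Let start_min (v e : R) := [set w | V0 w = v] `&` min_ge T t (- e).

Let mV0 : measurable_fun setT V0. Proof. by case: driver => _ []. Qed.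

Let measurable_start v : measurable [set w | V0 w = v].
Proof.
rewrite (_ : [set w | _] = V0 @^-1` [set v])//.
by rewrite -[X in measurable X]setTI; exact: mV0.
Qed.

Let measurable_start_min v e : measurable (start_min v e).
Proof.
by apply: measurableI => //; exact: (measurable_min_ge t_gt0 driver).
Qed.

Let tail_law v e x :
  restricted_law P (measurable_start_min v e) mT `[x, +oo[%classic = P (tail v e x).
Proof.
rewrite /restricted_law setIC; congr (P (_ `&` _)).
by apply/seteqP; split => w; rewrite /= in_itv/= andbT.
Qed.

Let min_le_end (e : R) w : min_ge T t (- e) w -> - e <= T t w.
Proof.
have [poissonN _ _] := driver.
move=> /(inf_signed_path_geP (poisson_homo poissonN w) (V0 w) _ t_gt0)/(_ 0%N 1%N isT).
by rewrite divr1 mulr1.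
Qed.

Let tail_low v e x : x <= - e -> tail v e x = tail v e (- e).
Proof.
move=> xe; apply/seteqP; split => w [[Vw mw] xw]; split => //.
  exact: min_le_end.
exact: le_trans xw.
Qed.

Let tail_high v e x : `|v| = c -> c * t < x -> tail v e x = set0.
Proof.
move=> vc xct; apply/seteqP; split => // w [[Vw _] /=]; rewrite leNgt => /negP; apply.
apply: le_lt_trans xct; rewrite -vc -Vw.
apply: le_trans (telegraph_le (P := P) (lam := lam) (c := c) driver w (ltW t_gt0)).
exact: ler_norm.
Qed.

Let exists_J : exists J : R -> R,
  forall z, 0 <= z <= lam * t -> is_derive z 1 J (sk01 (lam * t) z).
Proof. by apply: exists_antiderivative; exact: continuous_sk01. Qed.

(** A start with velocity - c leaves the half-line at once: [tail_event_down] with e = 0 gives the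
    integral over a degenerate interval. Other values of [V0] are null because the two halves add up
    to 1. *)
Let A0E : P (min_ge T t 0) = P (start_min c 0).
Proof.
have mE := measurable_min_ge t_gt0 driver 0.
have [J derJ] := exists_J.
have [_ [_ Pc PNc] _] := driver.
have down0 : P ([set w | V0 w = - c] `&` min_ge T t 0) = 0%E.
  have := tail_event_down lam_gt0 c_gt0 t_gt0 driver derJ (e := 0) (x := 0).
  rewrite oppr0 mulr0 addr0 min_l ?(ltW ct0)// subrr mulr0 lexx ct0 => /(_ isT isT).
  rewrite (_ : tail _ _ _ = [set w | V0 w = - c] `&` min_ge T t 0)//.
  apply/seteqP; split => w; rewrite /tail_event oppr0.
    by case.
  by move=> [Vw mw]; split => //; have := @min_le_end 0 w; rewrite oppr0; apply.
have ne : c != - c by rewrite -addr_eq0 gt_eqF// addr_gt0.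
have other0 : P (~` ([set w | V0 w = c] `|` [set w | V0 w = - c])) = 0%E.
  rewrite probability_setC; last exact: measurableU.
  rewrite measureU//; last first.
    by apply/seteqP; split => // w [/= -> /eqP]; rewrite (negbTE ne).
  rewrite [X in (1 - (X + _))%E]Pc [X in (1 - (_ + X))%E]PNc -EFinD.
  have -> : 2^-1 + 2^-1 = 1 :> R by lra.
  by rewrite subrr.
rewrite /start_min oppr0.
apply/eqP; rewrite eq_le; apply/andP; split; last first.
  by apply: le_measure; rewrite ?inE//; (exact: measurableI || exact: subIsetr).
have mB : measurable ([set w | V0 w = - c] `&` min_ge T t 0) by exact: measurableI.
have mC : measurable (~` ([set w | V0 w = c] `|` [set w | V0 w = - c])).
  by apply: measurableC; exact: measurableU.
have mA : measurable ([set w | V0 w = c] `&` min_ge T t 0) by exact: measurableI.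
rewrite -[leRHS]adde0 -other0 -[X in (_ <= X + _)%E]adde0 -[X in (_ <= _ + X + _)%E]down0.
apply: le_trans (leeD (measureU2 _ mA mB) (lexx _)).
apply: le_trans (measureU2 _ (measurableU _ _ mA mB) mC).
apply: le_measure; rewrite ?inE//; try by apply: measurableU => //; exact: measurableU.
move=> w mw; have [Vc|Vc] := pselect (V0 w = c); first by left; left.
have [VNc|VNc] := pselect (V0 w = - c); first by left; right.
by right => -[].
Qed.

Let cprob0E A : measurable A ->
  cprob P (min_ge T t 0) (T t @^-1` A) =
  (restricted_law P (measurable_start_min c 0) mT A / P (start_min c 0))%E.
Proof.
move=> mA; rewrite /cprob A0E; congr (_ / _)%E.
have mTA : measurable (T t @^-1` A) by rewrite -[X in measurable X]setTI; exact: mT.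
have mE := measurable_min_ge t_gt0 driver 0.
rewrite /restricted_law; apply/eqP; rewrite eq_le; apply/andP; split; last first.
  apply: le_measure; rewrite ?inE//; try exact: measurableI.
  by move=> w [Aw [_]]; rewrite oppr0.
have diff0 : P (min_ge T t 0 `\` start_min c 0) = 0%E.
  rewrite measureD//=; last by rewrite ltey_eq fin_num_measure.
  rewrite setIidr; last by move=> w [_]; rewrite oppr0.
  by rewrite A0E subee// fin_num_measure.
have mD : measurable (min_ge T t 0 `\` start_min c 0) by exact: measurableD.
have mB : measurable (T t @^-1` A `&` start_min c 0) by exact: measurableI.
rewrite -[leRHS]adde0 -diff0; apply: le_trans (measureU2 _ mB mD).
apply: le_measure; rewrite ?inE//; try exact: measurableI; try exact: measurableU.
move=> w [Aw mw]; have [sw|sw] := pselect (start_min c 0 w).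
  by left.
by right.
Qed.

Let divE (Z : R) (x : \bar R) : 0 < Z -> (x / Z%:E)%E = ((Z^-1)%:E * x)%E.
Proof. by move=> Z0; rewrite muleC inver gt_eqF. Qed.

Definition meander_pdf : R -> R := (fun z => - dp_ext z / p_ext 0) \_ `[0, c * t[.

Let p_ext0_gt0 : 0 < p_ext 0.
Proof. by apply: p_ext_gt0 => //; have := ct0; lra. Qed.

Lemma meander_pdf_ge0 x : 0 <= meander_pdf x.
Proof.
rewrite /meander_pdf patchE; case: ifP => //; rewrite inE/= in_itv/= => /andP[x0 xct].
by rewrite divr_ge0 ?(ltW p_ext0_gt0)// oppr_ge0 dp_ext_le0// x0 ltW.
Qed.

Let continuous_meander_pdf : continuous (fun z => - dp_ext z / p_ext 0).
Proof.
move=> z; apply: cvgM; last exact: cvg_cst.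
by apply: cvgN; exact: continuous_dp_ext.
Qed.

Lemma measurable_meander_pdf : measurable_fun setT meander_pdf.
Proof.
apply/(measurable_restrictT _ _).1 => //; apply: measurable_funTS.
exact: continuous_measurable_fun.
Qed.

(** The atom comes from the path that never turns: its weight is [expR] (- lam t) over the survival
    probability, and it cancels the boundary term at c t of the integrated density. *)
Lemma meander_law_density A : measurable A ->
  cprob P (min_ge T t 0) (T t @^-1` A) =
  (\int[mu]_(x in A) (meander_pdf x)%:E + (p_ext (c * t) / p_ext 0)%:E * \d_(c * t)%R A)%E.
Proof.
move=> mA; rewrite cprob0E//.
have Z : P (start_min c 0) = (2^-1 * sk01 (lam * t) (ups_scale 0))%:E.
  rewrite -(tail_event_up lam_gt0 c_gt0 t_gt0 driver (x := 0)) ?lexx ?(ltW ct0)//.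
  congr (P _); apply/seteqP; split => w; last by case.
  by move=> [Vw mw]; split => //; have := min_le_end mw; rewrite oppr0.
have s0 : 0 < sk01 (lam * t) (ups_scale 0).
  by apply: sk01_gt0; apply: ups_scale_itv => //; have := ct0; lra.
have Z0 : 0 < 2^-1 * sk01 (lam * t) (ups_scale 0) by rewrite mulr_gt0.
rewrite Z divE//.
have r0 : 0 <= p_ext (c * t) / p_ext 0.
  by rewrite divr_ge0// ltW// p_ext_gt0//; have := ct0; lra.
have Zi0 : 0 <= (2^-1 * sk01 (lam * t) (ups_scale 0))^-1 by rewrite invr_ge0 ltW.
pose m1 := mscale (NngNum Zi0) (restricted_law P (measurable_start_min c 0) mT).
pose m2 := measure_add (density_measure measurable_meander_pdf meander_pdf_ge0)
  (mscale (NngNum r0) (dirac (c * t : measurableTypeR R))).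
suff : m1 A = m2 A by rewrite /m2 measure_addE.
have tailE (x : R) : P (tail c 0 x) = ((x <= c * t)%R%:R *
    (2^-1 * sk01 (lam * t) (ups_scale (Num.max 0 (Num.min x (c * t))))))%:E.
  have [xct|ctx] := leP x (c * t); last first.
    by rewrite tail_high ?gtr0_norm// measure0 mul0r.
  rewrite mul1r -(tail_event_up lam_gt0 c_gt0 t_gt0 driver); last first.
    by rewrite le_max lexx ge_max (ltW ct0).
  case: (leP 0 x) => // /ltW x0.
  by rewrite tail_low ?oppr0.
have raysE (x : R) : m1 `[x, +oo[%classic =
    (((2^-1 * sk01 (lam * t) (ups_scale 0))^-1)%:E * P (tail c 0 x))%E.
  by rewrite -tail_law.
apply: measure_eq_rays => // x; last first.
  by change (m1 `[x, +oo[%classic < +oo)%E; rewrite raysE tailE -EFinM ltry.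
change (m1 `[x, +oo[%classic = m2 `[x, +oo[%classic).
rewrite raysE tailE -EFinM /m2 measure_addE.
have densE : density_measure measurable_meander_pdf meander_pdf_ge0 `[x, +oo[%classic =
    (- p_ext (c * t) / p_ext 0 - - p_ext (Num.max 0 (Num.min x (c * t))) / p_ext 0)%:E.
  apply: (integral_patch_ray (g := fun z => - dp_ext z / p_ext 0)
    (G := fun z => - p_ext z / p_ext 0)).
  - exact: ltW.
  - exact: continuous_meander_pdf.
  - move=> z _; have D : is_derive z 1 p_ext (dp_ext z) by exact: is_derive_p_ext.
    have hc := is_derive_cst ((p_ext 0)^-1 : R) z (1 : R).
    apply: (is_derive_eq (is_deriveM (is_deriveN D) hc)).
    by rewrite /GRing.scale/=; ring.
have atomE : mscale (NngNum r0) (dirac (c * t : measurableTypeR R)) `[x, +oo[%classic =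
    (p_ext (c * t) / p_ext 0 * (x <= c * t)%R%:R)%:E.
  by rewrite /mscale /= diracE mem_setE/= in_itv/= andbT.
have sumE := congr2 (fun a b : \bar R => a + b)%E densE atomE.
rewrite /= -EFinD in sumE; apply: etrans (esym sumE); congr EFin.
have k0 : lam / (2 * c) != 0 by rewrite gt_eqF// divr_gt0// mulr_gt0.
have [xct|ctx] := leP x (c * t).
  rewrite mul1r mulr1 !mulNr opprK addrAC addNr add0r /p_ext.
  by field; rewrite !gt_eqF.
by rewrite max_r ?(ltW ct0)// subrr mul0r !mulr0 addr0.
Qed.

Variable J : R -> R.
Hypothesis derJ : forall z, 0 <= z <= lam * t -> is_derive z 1 J (sk01 (lam * t) z).

Let A (z : R) := J (ups_scale z).

Let derA z : - (c * t) <= z <= c * t -> is_derive z 1 A (p_ext z).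
Proof.
move=> zct; have D := derJ (ups_scale_itv lam_gt0 c_gt0 zct).
apply: (is_derive_eq (is_derive1_comp D (is_derive_ups_scale lam t c_gt0 z))).
by rewrite /p_ext mulrC.
Qed.

Let derA_shift e z : - (c * t) <= z + 2 * e <= c * t ->
  is_derive z 1 (fun z => A (z + 2 * e)) (p_ext (z + 2 * e)).
Proof.
move=> zct; have D := derA zct.
have S : is_derive z 1 (fun z => z + 2 * e) 1.
  by apply: is_derive_eq; rewrite addr0.
apply: (is_derive_eq (@is_derive1_comp _ A (fun z => z + 2 * e) _ _ _ D S)).
by rewrite mulr1.
Qed.

(** The conditional probability of a minimum >= - e given V(0) = - c, read off from the tail at x =
    - e. *)
Let den e := A e - A (- e).

Let den_gt0 e : 0 < e < c * t -> 0 < den e.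
Proof.
move=> /andP[e0 ect]; have k0 : 0 < lam / c by rewrite divr_gt0.
have h1 : 0 <= ups_scale (- e) <= lam * t by apply: ups_scale_itv => //; lra.
have h2 : 0 <= ups_scale e <= lam * t by apply: ups_scale_itv => //; lra.
have h : ups_scale (- e) < ups_scale e.
  by rewrite !ups_scaleE// ltr_pM2r// ltr_pM2l//; lra.
have /andP[h1l _] := h1; have /andP[_ h2r] := h2.
have [z /andP[z1 z2] zE] := J_mvt derJ h1l (ltW h) h2r.
rewrite /den /A zE mulr_gt0 ?subr_gt0// sk01_gt0//.
by rewrite (le_trans h1l)// (le_trans z2).
Qed.

Let pdf1 e z := (p_ext z - p_ext (z + 2 * e)) / den e.

Let pdf2 e z := p_ext z / den e.

(** Two pieces, as the tail formula truncates x + 2 e at c t. For 0 < e < c t the density jumps at c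
    t - 2 e, hence continuity only to the left of that point. *)
Definition conditional_pdf (e z : R) : R :=
  (pdf1 e \_ `[- e, c * t - 2 * e[) z + (pdf2 e \_ `[c * t - 2 * e, c * t[) z.

Let continuous_pdf1 e : continuous (pdf1 e).
Proof.
move=> z; apply: cvgM; last exact: cvg_cst.
apply: cvgB; first exact: continuous_p_ext.
apply: (@continuous_comp _ _ _ (fun z => z + 2 * e) p_ext).
  by apply: cvgD; [exact: cvg_id|exact: cvg_cst].
exact: continuous_p_ext.
Qed.

Let continuous_pdf2 e : continuous (pdf2 e).
Proof. by move=> z; apply: cvgM; [exact: continuous_p_ext|exact: cvg_cst]. Qed.

Let measurable_patch (g : R -> R) (a b : R) : continuous g ->
  measurable_fun setT (g \_ `[a, b[).
Proof.
move=> cg; apply/(measurable_restrictT _ _).1 => //; apply: measurable_funTS.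
exact: continuous_measurable_fun.
Qed.

Let pdf1_ge0 e z : 0 < e < c * t -> 0 <= (pdf1 e \_ `[- e, c * t - 2 * e[) z.
Proof.
move=> e0ct; have d0 := den_gt0 e0ct; have /andP[e0 ect] := e0ct.
rewrite patchE; case: ifP => //; rewrite inE/= in_itv/= => /andP[ez zct].
rewrite divr_ge0 ?(ltW d0)// subr_ge0.
have [z0|z0] := leP 0 z.
  by apply: p_ext_le => //; lra.
(* For - e <= z < 0 one has 0 < - z <= z + 2 e, where [p_ext] decreases; flipping the sign then
   compares with z. *)
apply: (@le_trans _ _ (p_ext (- z))); first by apply: p_ext_le => //; lra.
by rewrite -{2}(opprK z); apply: p_ext_flip_le => //; lra.
Qed.

Let pdf2_ge0 e z : 0 < e < c * t -> 0 <= (pdf2 e \_ `[c * t - 2 * e, c * t[) z.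
Proof.
move=> e0ct; have d0 := den_gt0 e0ct; have /andP[e0 ect] := e0ct.
rewrite patchE; case: ifP => //; rewrite inE/= in_itv/= => /andP[ez zct].
by rewrite divr_ge0 ?(ltW d0)// ltW// p_ext_gt0//; lra.
Qed.

Lemma conditional_pdf_ge0 e z : 0 < e < c * t -> 0 <= conditional_pdf e z.
Proof. by move=> ect; rewrite addr_ge0 ?pdf1_ge0 ?pdf2_ge0. Qed.

Lemma measurable_conditional_pdf e : measurable_fun setT (conditional_pdf e).
Proof.
by apply: measurable_funD; apply: measurable_patch;
  [exact: continuous_pdf1|exact: continuous_pdf2].
Qed.

Lemma conditional_pdfE e z : 0 < e -> 0 <= z < c * t - 2 * e ->
  conditional_pdf e z = pdf1 e z.
Proof.
move=> e0 /andP[z0 zct]; rewrite /conditional_pdf !patchE mem_set/=; last first.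
  by rewrite in_itv/= zct andbT; lra.
by rewrite memNset ?addr0//= in_itv/= leNgt zct.
Qed.

Lemma conditional_law_density e B : 0 < e < c * t -> measurable B ->
  cprob P (min_ge T t (- e) `&` V0 @^-1` [set - c]) (T t @^-1` B) =
  (\int[mu]_(x in B) (conditional_pdf e x)%:E)%E.
Proof.
move=> e0ct mB; have /andP[e0 ect] := e0ct.
rewrite /cprob (setIC (min_ge _ _ _)) -/(start_min (- c) e).
(* The tail is constant below - e and zero above c t, so clamping x extends the formula to every
   ray. *)
have tailE (x : R) (x' := Num.max (- e) (Num.min x (c * t))) :
    P (tail (- c) e x) =
    (2^-1 * (A (Num.min (x' + 2 * e) (c * t)) - A x'))%:E.
  have ex' : - e <= x' by rewrite le_max lexx.
  have x'ct : x' <= c * t by rewrite ge_max ge_min lexx orbT andbT; lra.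
  rewrite -(tail_event_down lam_gt0 c_gt0 t_gt0 driver derJ); last 2 first.
  - by rewrite (ltW e0).
  - by rewrite ex'.
  have [xe|ex] := leP x (- e).
    have xct : x <= c * t by lra.
    by rewrite (tail_low _ xe) /x' (min_l xct) (max_l xe).
  have [xct|ctx] := leP x (c * t); first by rewrite /x' (min_l xct) (max_r (ltW ex)).
  have -> : x' = c * t by rewrite /x' (min_r (ltW ctx)) max_r//; lra.
  rewrite tail_high ?normrN ?gtr0_norm// measure0.
  rewrite (tail_event_down lam_gt0 c_gt0 t_gt0 driver derJ) ?(ltW e0)//; last by lra.
  by rewrite min_r ?subrr ?mulr0//; lra.
have d0 := den_gt0 e0ct.
have Z : P (start_min (- c) e) = (2^-1 * den e)%:E.
  transitivity (P (tail (- c) e (- e))).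
    congr (P _); apply/seteqP; split => w; last by case.
    by move=> [Vw mw]; split => //; exact: min_le_end.
  have ec : - e <= c * t by lra.
  rewrite tailE (min_l ec) maxxx (_ : - e + 2 * e = e); last by ring.
  by rewrite (min_l (ltW ect)).
have Z0 : 0 < 2^-1 * den e by rewrite mulr_gt0.
rewrite Z divE//.
have Zi0 : 0 <= (2^-1 * den e)^-1 by rewrite invr_ge0 ltW.
pose m1 := mscale (NngNum Zi0) (restricted_law P (measurable_start_min (- c) e) mT).
have pdf0 z := conditional_pdf_ge0 z e0ct.
pose m2 := density_measure (measurable_conditional_pdf e) pdf0.
suff : m1 B = m2 B by [].
have raysE (x : R) : m1 `[x, +oo[%classic = ((2^-1 * den e)^-1%:E *
    P (tail (- c) e x))%E.
  by rewrite -tail_law.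
apply: measure_eq_rays => // x; last first.
  by change (m1 `[x, +oo[%classic < +oo)%E; rewrite raysE tailE -EFinM ltry.
change (m1 `[x, +oo[%classic = m2 `[x, +oo[%classic).
rewrite raysE tailE -EFinM /m2 /density_measure.
under [RHS]eq_integral do rewrite EFinD.
rewrite ge0_integralD//=; last 4 first.
- by move=> z _; rewrite lee_fin pdf1_ge0.
- apply/measurable_EFinP/measurable_funTS.
  exact: (measurable_patch _ _ (@continuous_pdf1 e)).
- by move=> z _; rewrite lee_fin pdf2_ge0.
- apply/measurable_EFinP/measurable_funTS.
  exact: (measurable_patch _ _ (@continuous_pdf2 e)).
have hc z := is_derive_cst ((den e)^-1 : R) z (1 : R).
have i1 := @integral_patch_ray R (pdf1 e) (fun z => (A z - A (z + 2 * e)) / den e)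
  (- e) (c * t - 2 * e) x ltac:(lra) (@continuous_pdf1 e).
have {}i1 := i1 ltac:(move=> z zct;
  have D1 := derA (z := z) ltac:(lra);
  have D2 := derA_shift (e := e) (z := z) ltac:(lra);
  apply: (is_derive_eq (is_deriveM (is_deriveB D1 D2) (hc z)));
  by rewrite /GRing.scale/= /pdf1; ring).
have i2 := @integral_patch_ray R (pdf2 e) (fun z => A z / den e)
  (c * t - 2 * e) (c * t) x ltac:(lra) (@continuous_pdf2 e).
have {}i2 := i2 ltac:(move=> z zct; have D1 := derA (z := z) ltac:(lra);
  apply: (is_derive_eq (is_deriveM D1 (hc z)));
  by rewrite /GRing.scale/= /pdf2; ring).
rewrite i1 i2.
rewrite -EFinD; congr EFin.
have dn0 : den e != 0 by rewrite gt_eqF.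
rewrite (_ : c * t - 2 * e + 2 * e = c * t); last by ring.
have [xb|bx] := leP x (c * t - 2 * e).
  have -> : Num.min x (c * t) = x by rewrite min_l//; lra.
  rewrite (max_l xb).
  have -> : Num.min (Num.max (- e) x + 2 * e) (c * t) = Num.max (- e) x + 2 * e.
    by rewrite min_l//; case: (leP (- e) x) => ?; lra.
  by field.
have hx : - e <= Num.min x (c * t) by case: (leP x (c * t)) => ?; lra.
have hx' : c * t - 2 * e <= Num.min x (c * t) by case: (leP x (c * t)) => ?; lra.
rewrite (max_r hx) (max_r hx') (max_r (_ : - e <= c * t - 2 * e)); last by lra.
rewrite (_ : c * t - 2 * e + 2 * e = c * t); last by ring.
rewrite min_r; last by lra.
by field.
Qed.

(** Numerator and denominator both vanish with e. Divided by e they tend to - 2 [dp_ext x] and to 2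
    [p_ext 0], the latter as a sum of difference quotients at 0 from both sides. *)
Lemma conditional_pdf_cvg x : 0 <= x < c * t ->
  conditional_pdf e x @[e --> 0^'+] --> - dp_ext x / p_ext 0.
Proof.
move=> /andP[x0 xct].
have D : is_derive x 1 p_ext (dp_ext x) by exact: is_derive_p_ext.
have D0 := derA (z := 0) ltac:(have := ct0; lra).
have n0 : 2 != 0 :> R by [].
have c1 := right_difference_quotient n0 D.
have c2 := right_difference_quotient (oner_neq0 R) D0.
have c3 := right_difference_quotient (_ : -1 != 0 :> R) D0.
have {}c3 := c3 ltac:(by rewrite oppr_eq0 oner_neq0).
have p0 : p_ext 0 + p_ext 0 != 0 by rewrite gt_eqF// addr_gt0.
have -> : - dp_ext x / p_ext 0 = - (dp_ext x * (2 * (p_ext 0 + p_ext 0)^-1)).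
  by field; rewrite p0 (gt_eqF p_ext0_gt0).
apply: cvg_trans (cvgN (cvgM c1 (cvgM (cvg_cst (2 : R)) (cvgV p0 (cvgD c2 c3))))).
apply: near_eq_cvg; near=> e.
have e0 : 0 < e by [].
have ex : e < (c * t - x) / 2.
  by near: e; apply: nbhs_right_lt; rewrite divr_gt0// subr_gt0.
rewrite /= conditional_pdfE ?x0 /=; [|by []|by lra].
have dn0 : den e != 0 by rewrite gt_eqF// den_gt0//; lra.
transitivity (- ((p_ext (x + 2 * e) - p_ext x) / (2 * e) *
  (2 * ((A (0 + 1 * e) - A 0) / (1 * e) + (A (0 + -1 * e) - A 0) / (-1 * e))^-1))).
  by [].
rewrite /pdf1 !add0r !mul1r !mulN1r.
have -> : (A e - A 0) / e + (A (- e) - A 0) / - e = den e / e.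
  by rewrite /den; field; rewrite gt_eqF.
by field; rewrite dn0 gt_eqF.
Unshelve. all: by end_near. Qed.

End Densities.

Lemma ac_density_of_density (R : realType) (m : set R -> \bar R) (f : R -> R) :
  is_density m f -> is_ac_density m f.
Proof.
move=> [mf f0 fm]; split => //; exists mzero.
  by exists set0; split; rewrite ?measure0.
by move=> B mB; rewrite /mzero adde0 fm.
Qed.

(** * Identification of the densities *)

Section MainTheorem.
Context (R : realType) (lam c t : R).
Hypotheses (lam_gt0 : 0 < lam) (c_gt0 : 0 < c) (t_gt0 : 0 < t).
Context (d : measure_display) (W : measurableType d).
Variables (P : probability W R) (N : R -> W -> nat) (V0 : W -> R).
Hypothesis driver : telegraph_driver P lam c N V0.
Context (d' : measure_display) (W' : measurableType d').
Variables (P' : probability W' R) (Tp : R -> W' -> R).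
Hypothesis meander : telegraph_meander P N V0 t P' Tp.

Let ct0 : 0 < c * t. Proof. exact: mulr_gt0. Qed.

Lemma meander_endpoint_law B : measurable B ->
  P' (Tp t @^-1` B) =
  cprob P (min_ge (telegraph N V0) t 0) (telegraph N V0 t @^-1` B).
Proof.
move=> mB; apply: (meander_law meander (A := [set pi : R -> R | B (pi t)])).
apply: sub_sigma_algebra; exists t; first by rewrite /= in_itv/= (ltW t_gt0) lexx.
by exists B => //; rewrite setTI.
Qed.

Lemma meander_density_pdf : meander_density c t P' Tp (meander_pdf lam c t).
Proof.
split; last first.
  apply: (@continuous_within_eq _ _ _ (fun z => - dp_ext lam c t z / p_ext lam c t 0)).
    move=> z; apply: cvgM; last exact: cvg_cst.
    by apply: cvgN; exact: continuous_dp_ext.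
  by move=> z /= zct; rewrite /meander_pdf patchE mem_set.
have r0 : 0 <= p_ext lam c t (c * t) / p_ext lam c t 0.
  by rewrite divr_ge0// ltW// p_ext_gt0//; have := ct0; lra.
split.
- exact: measurable_meander_pdf.
- by move=> x; exact: meander_pdf_ge0.
(* The singular component is the atom at c t, carried by a single point. *)
exists (mscale (NngNum r0) (dirac (c * t : R))).
  exists [set c * t]; split => //; first exact: lebesgue_measure_set1.
  transitivity ((p_ext lam c t (c * t) / p_ext lam c t 0)%:E *
    \d_(c * t)%R (~` [set (c * t)%R]))%E; first by [].
  by rewrite diracE memNset ?mule0// => /(_ erefl).
move=> B mB; rewrite meander_endpoint_law//.
by rewrite (meander_law_density lam_gt0 c_gt0 t_gt0 driver).
Qed.

Variable J : R -> R.
Hypothesis derJ : forall z, 0 <= z <= lam * t -> is_derive z 1 J (sk01 (lam * t) z).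

Lemma conditional_density_pdf eps : 0 < eps < c * t ->
  conditional_density P N V0 c t eps (conditional_pdf lam c t J eps).
Proof.
move=> epsct; have /andP[eps0 _] := epsct; split; first split.
- exact: measurable_conditional_pdf.
- by move=> x; exact: conditional_pdf_ge0.
- by move=> B mB; exact: (conditional_law_density lam_gt0 c_gt0 t_gt0 driver).
apply: (@continuous_within_eq _ _ _ (fun z =>
    (p_ext lam c t z - p_ext lam c t (z + 2 * eps)) /
    (J (ups_scale lam c t eps) - J (ups_scale lam c t (- eps))))).
  move=> z; apply: cvgM; last exact: cvg_cst.
  apply: cvgB; first exact: continuous_p_ext.
  apply: (@continuous_comp _ _ _ (fun z => z + 2 * eps) (p_ext lam c t)).
    by apply: cvgD; [exact: cvg_id|exact: cvg_cst].
  exact: continuous_p_ext.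
by move=> z; rewrite /= in_itv/= => zct; exact: conditional_pdfE.
Qed.

Lemma meander_density_eq q x : meander_density c t P' Tp q -> 0 <= x < c * t ->
  q x = - dp_ext lam c t x / p_ext lam c t 0.
Proof.
move=> [acq cq] xct; have [acp cp] := meander_density_pdf.
have -> : - dp_ext lam c t x / p_ext lam c t 0 = meander_pdf lam c t x.
  by rewrite /meander_pdf patchE mem_set.
exact: (ac_density_unique acq acp cq cp xct).
Qed.

Lemma conditional_density_eq eps f x : 0 < eps < c * t ->
  conditional_density P N V0 c t eps f -> 0 <= x < c * t - 2 * eps ->
  f x = conditional_pdf lam c t J eps x.
Proof.
move=> epsct [df cf] xct; have [dp cp] := conditional_density_pdf epsct.
exact: (ac_density_unique (ac_density_of_density df) (ac_density_of_density dp)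
  cf cp xct).
Qed.

End MainTheorem.

Theorem theorem2p2 (R : realType) (lam c t : R)
    (lam_gt0 : 0 < lam) (c_gt0 : 0 < c) (t_gt0 : 0 < t)
    (d : measure_display) (W : measurableType d) (P : probability W R)
    (N : R -> W -> nat) (V0 : W -> R)
    (driver : telegraph_driver P lam c N V0)
    (d' : measure_display) (W' : measurableType d') (P' : probability W' R)
    (Tp : R -> W' -> R) (meander : telegraph_meander P N V0 t P' Tp) :
  (exists q : R -> R, meander_density c t P' Tp q) /\
  (exists f : R -> R -> R,
     \forall eps \near 0^'+, conditional_density P N V0 c t eps (f eps)) /\
  (forall (q : R -> R) (f : R -> R -> R),
     meander_density c t P' Tp q ->
     (\forall eps \near 0^'+, conditional_density P N V0 c t eps (f eps)) ->
     forall x : R, 0 <= x < c * t ->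
       [/\ f eps x @[eps --> 0^'+] --> q x,
           derivable (p_minus lam c t) x 1 &
           q x = - (derive1 (p_minus lam c t) x / p_minus lam c t 0)]).
Proof.
have ct0 : 0 < c * t by rewrite mulr_gt0.
have [J derJ] := exists_antiderivative 0 (lam * t) (@continuous_sk01 R (lam * t)).
split; [|split].
- exists (meander_pdf lam c t).
  exact: (meander_density_pdf lam_gt0 c_gt0 t_gt0 driver).
- exists (conditional_pdf lam c t J); near=> eps.
  apply: (conditional_density_pdf lam_gt0 c_gt0 t_gt0 driver derJ).
  by apply/andP; split => //; near: eps; exact: nbhs_right_lt.
move=> q f qd fd x xct; have /andP[x0 xct'] := xct.
have qE := meander_density_eq lam_gt0 c_gt0 t_gt0 driver meander qd xct.
have D : is_derive x 1 (p_minus lam c t) (dp_ext lam c t x).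
  by apply: is_derive_p_minus => //; apply/andP; split; lra.
split; last 2 first.
- exact: (@ex_derive _ _ _ _ _ _ _ D).
- rewrite derive1E (@derive_val _ _ _ _ _ _ _ D) qE p_minusE ?mulNr//.
  by rewrite oppr_lt0 ct0.
rewrite qE; apply: cvg_trans (conditional_pdf_cvg lam_gt0 c_gt0 t_gt0 derJ xct).
apply: near_eq_cvg; near=> eps.
have eps0 : 0 < eps by [].
(* Then x lies in [0, c t - 2 eps), where every admissible [f eps] agrees with [conditional_pdf]. *)
have eps1 : eps < (c * t - x) / 2.
  by near: eps; apply: nbhs_right_lt; rewrite divr_gt0// subr_gt0.
apply/esym/(conditional_density_eq lam_gt0 c_gt0 t_gt0 driver derJ).
- by apply/andP; split; lra.
- by near: eps.
- by apply/andP; split; lra.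
Unshelve. all: by end_near. Qed.
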